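(* Let $k,n,N\in\mathbb{N}$ with $1\le k<n$, and let $$\mathcal{L}^n=\mathcal{Q}_n-\sum_{i=1}^N\Big(\frac{a_i}{p_i}+\frac{a_i}{p-p_i}\Big),\qquad \mathcal{Q}_n=(\mathcal{L}^n)_{\ge 1},$$ be the $n$-th power of a Sato function $\mathcal{L}=p+\sum_{j\ge0}V_j(T)p^{-j}$, where $a_i=a_i(T)$, $p_i=p_i(T)$. Put $\mathcal{Q}_k=[(\mathcal{L}^n)^{k/n}]_{\ge 1}$. Suppose that the dispersionless mKP hierarchy with self-consistent sources holds: for $i=1,\dots,N$, $$(\mathcal{Q}_k)_{T_n}-(\mathcal{L}^n)_{T_k}+\{\mathcal{Q}_k,\mathcal{L}^n\}=0,\qquad a_{i,T_k}=\Big[a_i\Big(\tfrac{\partial}{\partial p}\mathcal{Q}_k(p)\Big)\Big|_{p=p_i}\Big]_X,\qquad p_{i,T_k}=\big[\mathcal{Q}_k(p)|_{p=p_i}\big]_X ,$$ and let $P=P(T)$ be a function satisfying the corresponding conservation equations $$P_{T_k}=[\mathcal{Q}_k(P)]_X,\qquad P_{T_n}=\Big[\mathcal{Q}_n(P)-\sum_{i=1}^N\Big(\frac{a_i}{p_i}+\frac{a_i}{P-p_i}\Big)\Big]_X .$$ Let $\phi=\phi(T)$ be a function satisfying $$\phi_{T_k}=\mathcal{Q}_k|_{p=\phi_X},\qquad \phi_{T_n}=\mathcal{Q}_n|_{p=\phi_X}-\sum_{i=1}^N\Big(\frac{a_i}{p_i}+\frac{a_i}{\phi_X-p_i}\Big).$$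 Define $\tilde a_i:=a_i$, $\tilde p_i:=p_i-\phi_X$ $(i=1,\dots,N)$ and $$\tilde{\mathcal{L}}^n:=\big[e^{-ad\phi}(\mathcal{L}^n)\big]_{\ge 1}-\sum_{i=1}^N\Big(\frac{\tilde a_i}{\tilde p_i}+\frac{\tilde a_i}{p-\tilde p_i}\Big).$$ Then, with $\tilde{\mathcal{Q}}_k=[(\tilde{\mathcal{L}}^n)^{k/n}]_{\ge 1}$, the dispersionless mKP hierarchy with self-consistent sources also holds for the transformed data: for $i=1,\dots,N$, $$(\tilde{\mathcal{Q}}_k)_{T_n}-(\tilde{\mathcal{L}}^n)_{T_k}+\{\tilde{\mathcal{Q}}_k,\tilde{\mathcal{L}}^n\}=0,\qquad \tilde a_{i,T_k}=\Big[\tilde a_i\Big(\tfrac{\partial}{\partial p}\tilde{\mathcal{Q}}_k(p)\Big)\Big|_{p=\tilde p_i}\Big]_X,\qquad \tilde p_{i,T_k}=\big[\tilde{\mathcal{Q}}_k(p)|_{p=\tilde p_i}\big]_X .$$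
   Context: $T=(T_1=X,T_2,T_3,\dots)$ are independent variables and all coefficient functions ($V_j,a_i,p_i,\phi$, etc.) are smooth functions of $T$; $p$ is a formal variable independent of $T$. All symbols such as $\mathcal{L},\tilde{\mathcal{L}}$ are formal Laurent series in $p^{-1}$ (finitely many positive powers of $p$) with coefficients functions of $T$; fractions $\frac{1}{p-\beta}$ are expanded as $\sum_{j\ge0}\beta^j p^{-j-1}$. Subscripts $T_k$, $X$ on a Laurent series denote coefficientwise partial derivatives with $p$ held fixed; subscripts on functions of $T$ denote partial derivatives, and $[\,\cdot\,]_X$ applied to an expression evaluated at $p=$ a function of $T$ is the derivative in $X$ of the resulting function of $T$. For $A=\sum_j c_jp^j$, $A_{\ge r}=\sum_{j\ge r}c_jp^j$. The Poisson bracket is $\{A,B\}=\frac{\partial A}{\partial p}\frac{\partial B}{\partial X}-\frac{\partial A}{\partial X}\frac{\partial B}{\partial p}$. For a series $M=p^n+\text{(lower powers of }p)$, $M^{1/n}$ is the unique series of the form $p+\text{(lower powers)}$ whose $n$-th power is $M$, and $M^{k/n}=(M^{1/n})^k$. The notation $\tilde{\mathcal{L}}^n$ denotes a series of the form $p^n+\text{lower}$, understood as the $n$-th power of $\tilde{\mathcal{L}}=(\tilde{\mathcal{L}}^n)^{1/n}$. For a function $\phi(T)$ and a series $\mu(p,T)$, $$e^{-ad\phi}(\mu)=\mu-\{\phi,\mu\}+\tfrac1{2!}\{\phi,\{\phi,\mu\}\}-\tfrac{1}{3!}\{\phi,\{\phi,\{\phi,\mu\}\}\}+\cdots=\sum_{l=0}^\infty\frac{1}{l!}(\phi_X)^l\,\partial_p^l\mu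 .$$ Convention: all denominators occurring that are functions of $T$ (here $p_i$, $\phi_X-p_i=-\tilde p_i$ and $P-p_i$) are nowhere zero. *)

(* Defs.v *)
From HB Require Import structures.
From mathcomp Require Import all_boot all_order all_algebra.
From mathcomp Require Import all_classical all_reals all_analysis.
From mathcomp Require Import zify ring.

Set Implicit Arguments.
Unset Strict Implicit.
Unset Printing Implicit Defensive.

Import Order.TTheory GRing.Theory Num.Theory.
Import numFieldNormedType.Exports.

Local Open Scope classical_set_scope.
Local Open Scope ring_scope.

(* Coordinate [i] of a point [T] is the variable T_(i+1); the topology on
   points is the product topology. *)
Notation time_space R := {ptws nat -> R}.

Section PartialDerivatives.
Variable R : realType.
Implicit Types (f g : time_space R -> R) (T : time_space R) (D : set (time_space R)).

Definition slice f (i : nat) T : R -> R := fun x => f (dfwith T i x).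

Definition partial (i : nat) f : time_space R -> R :=
  fun T => derive1 (slice f i T) (T i).

Definition iter_partial (s : seq nat) f : time_space R -> R :=
  foldr partial f s.

Definition smooth_on D f : Prop :=
  forall (s : seq nat) T, D T ->
    {for T, continuous (iter_partial s f)} /\
    forall i, derivable (slice (iter_partial s f) i T) (T i) 1.

Lemma dfwith_self T i : dfwith T i (T i) = T.
Proof. by apply/funext => j; case: dfwithP. Qed.

Lemma near_slice D T i : open D -> D T ->
  \forall x \near T i, D (dfwith T i x).
Proof.
move=> oD DT.
have nD : nbhs (dfwith T i (T i) : time_space R) D.
  by rewrite dfwith_self; exact: open_nbhs_nbhs.
exact: (@dfwith_continuous nat (fun=> R) T i (T i) D nD).
Qed.

Lemma eq_partial D f g T i : open D -> D T -> {in D, f =1 g} ->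
  partial i f T = partial i g T.
Proof.
move=> oD DT fg; rewrite /partial !derive1E; apply: near_eq_derive.
have := near_slice i oD DT; apply: filterS => x Dx.
by rewrite /slice fg // inE.
Qed.

Lemma eq_slice_derivable D f g T i : open D -> D T -> {in D, f =1 g} ->
  derivable (slice f i T) (T i) 1 -> derivable (slice g i T) (T i) 1.
Proof.
move=> oD DT fg; apply: near_eq_derivable.
have := near_slice i oD DT; apply: filterS => x Dx.
by rewrite /slice fg // inE.
Qed.

Lemma eq_continuous_at D f g T : open D -> D T -> {in D, f =1 g} ->
  {for T, continuous f} -> {for T, continuous g}.
Proof.
move=> oD DT fg cf.
have nfg : {near T, f =1 g}.
  have : nbhs T D by exact: open_nbhs_nbhs.
  by apply: filterS => x Dx; rewrite fg // inE.
rewrite /prop_for /continuous_at.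
have <- : f T = g T by rewrite fg // inE.
exact: cvg_trans (near_eq_cvg nfg) cf.
Qed.

(* A class of functions stable under partial derivatives consists of smooth
   functions. *)
Lemma smooth_class D (C : set (time_space R -> R)) : open D ->
  (forall f T, C f -> D T -> {for T, continuous f}) ->
  (forall f i, C f -> exists g, C g /\ forall T, D T ->
     is_derive (T i) 1 (slice f i T) (g T)) ->
  forall f, C f -> smooth_on D f.
Proof.
move=> oD Cc Cd f Cf.
have H s : exists g, C g /\ {in D, g =1 iter_partial s f}.
  elim: s => [|i s [g [Cg gE]]]; first by exists f.
  have [h [Ch hE]] := Cd _ i Cg; exists h; split=> // T; rewrite inE => DT /=.
  rewrite -(eq_partial i oD DT gE) /partial derive1E.
  by have [_ ->] := hE _ DT.
move=> s T DT; have [g [Cg gE]] := H s; split=> [|i].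
  by apply: (eq_continuous_at oD DT gE); exact: Cc.
apply: (eq_slice_derivable oD DT gE).
by have [h [Ch hE]] := Cd _ i Cg; have [] := hE _ DT.
Qed.

Lemma smooth_partial D f i : smooth_on D f -> smooth_on D (partial i f).
Proof.
move=> sf s T DT; have := sf (rcons s i) T DT.
by rewrite /iter_partial foldr_rcons.
Qed.

Lemma smooth_continuous D f T : smooth_on D f -> D T ->
  {for T, continuous f}.
Proof. by move=> sf DT; case: (sf [::] T DT). Qed.

Lemma smooth_is_derive D f T i : smooth_on D f -> D T ->
  is_derive (T i) 1 (slice f i T) (partial i f T).
Proof.
move=> sf DT; case: (sf [::] T DT) => _ /(_ i) /= df.
by apply: DeriveDef; [exact: df|rewrite /partial derive1E].
Qed.

Lemma eq_smooth D f g : open D -> {in D, f =1 g} ->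
  smooth_on D f -> smooth_on D g.
Proof.
move=> oD fg sf.
pose C := [set h | exists2 h', smooth_on D h' & {in D, h' =1 h}].
apply: (@smooth_class D C oD); last by exists f.
- move=> h T [h' sh' hE] DT; apply: (eq_continuous_at oD DT hE).
  exact: smooth_continuous sh' DT.
- move=> h i [h' sh' hE]; exists (partial i h'); split.
    exists (partial i h'); [exact: smooth_partial|by []].
  move=> T DT; apply: near_eq_is_derive (smooth_is_derive i sh' DT).
  have := near_slice i oD DT; apply: filterS => x Dx.
  by rewrite /slice hE // inE.
Qed.

Lemma smooth_cst D (c : R) : open D -> smooth_on D (cst c).
Proof.
move=> oD; apply: (@smooth_class D [set h | exists c, h = cst c] oD).
- by move=> h T [d ->] _; exact: cst_continuous.
- move=> h i [d ->]; exists (cst 0); split; first by exists 0.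
  by move=> T _; exact: is_derive_cst.
- by exists c.
Qed.

Lemma smoothD D f g : open D -> smooth_on D f -> smooth_on D g ->
  smooth_on D (fun T => f T + g T).
Proof.
move=> oD sf sg.
pose C := [set h : time_space R -> R | exists f g,
  [/\ smooth_on D f, smooth_on D g & h = fun T => f T + g T]].
apply: (@smooth_class D C oD); last by exists f, g.
- move=> _ T [u [v [su sv ->]]] DT.
  by apply: continuousD; [exact: smooth_continuous su DT|exact: smooth_continuous sv DT].
- move=> _ i [u [v [su sv ->]]].
  exists (fun T => partial i u T + partial i v T); split.
    exists (partial i u), (partial i v).
    by split; [exact: smooth_partial|exact: smooth_partial|].
  move=> T DT.
  exact: (is_deriveD (smooth_is_derive i su DT) (smooth_is_derive i sv DT)).
Qed.

Lemma smoothN D f : open D -> smooth_on D f -> smooth_on D (fun T => - f T).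
Proof.
move=> oD sf.
pose C := [set h : time_space R -> R | exists2 f,
  smooth_on D f & h = fun T => - f T].
apply: (@smooth_class D C oD); last by exists f.
- by move=> _ T [u su ->] DT; apply: continuousN; exact: smooth_continuous su DT.
- move=> _ i [u su ->].
  exists (fun T => - partial i u T); split.
    exists (partial i u); [exact: smooth_partial|by []].
  by move=> T DT; exact: (is_deriveN (smooth_is_derive i su DT)).
Qed.

Lemma smoothM D f g : open D -> smooth_on D f -> smooth_on D g ->
  smooth_on D (fun T => f T * g T).
Proof.
move=> oD sf sg.
pose smooth2 := [set u : (time_space R -> R) * (time_space R -> R) |
  smooth_on D u.1 /\ smooth_on D u.2].
pose ev (r : seq ((time_space R -> R) * (time_space R -> R))) (T : time_space R) :=
  \sum_(u <- r) u.1 T * u.2 T.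
pose C := [set h : time_space R -> R | exists2 r,
  (forall u, List.In u r -> smooth2 u) & h = ev r].
have CD u v : C u -> C v -> C (fun T => u T + v T).
  move=> [r sr ->] [s ss ->]; exists (r ++ s).
    by move=> w w_in; case: (List.in_app_or r s w w_in) => [/sr|/ss].
  by apply/funext => T; rewrite /ev big_cat.
apply: (@smooth_class D C oD); last first.
- exists [:: (f, g)]; first by move=> _ /= [<-|[]]; split; [exact: sf|exact: sg].
  by apply/funext => T; rewrite /ev big_seq1.
- move=> _ i [r sr ->]; elim: r sr => [|u r IH] sr.
    exists (fun=> 0); split.
      by exists [::] => //; apply/funext => T; rewrite /ev big_nil.
    move=> T DT; have -> : slice (ev [::]) i T = cst 0.
      by apply/funext => x; rewrite /slice /ev big_nil.
    exact: is_derive_cst.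
  have [su1 su2] : smooth2 u by apply: sr; left.
  have [w [Cw wE]] := IH (fun v rv => sr v (or_intror rv)).
  exists (fun T => ((u.1 T * partial i u.2 T) + (partial i u.1 T * u.2 T)) + w T).
  split.
    apply: CD; last exact: Cw.
    exists [:: (u.1, partial i u.2); (partial i u.1, u.2)].
      move=> _ /= [<-|[<-|//]].
        by split; [exact: su1|exact: smooth_partial].
      by split; [exact: smooth_partial|exact: su2].
    by apply/funext => T; rewrite /ev big_cons big_seq1.
  move=> T DT.
  have -> : slice (ev (u :: r)) i T =
      (slice u.1 i T * slice u.2 i T) + slice (ev r) i T.
    by apply/funext => x; rewrite /slice /ev big_cons.
  apply: (is_deriveD _ (wE T DT)).
  apply: is_derive_eq.
    exact: (is_deriveM (smooth_is_derive i su1 DT) (smooth_is_derive i su2 DT)).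
  by rewrite /slice !dfwith_self /GRing.scale /= [u.2 T * _]mulrC.
- move=> _ T [r sr ->] DT; elim: r sr => [|u r IH] sr.
    have -> : ev [::] = cst 0 by apply/funext => x; rewrite /ev big_nil.
    exact: cst_continuous.
  have -> : ev (u :: r) = fun T => u.1 T * u.2 T + ev r T.
    by apply/funext => x; rewrite /ev big_cons.
  have [su1 su2] : smooth2 u by apply: sr; left.
  apply: continuousD; last by apply: IH => v rv; apply: sr; right.
  by apply: continuousM; [exact: smooth_continuous su1 DT|exact: smooth_continuous su2 DT].
Qed.

Lemma smoothV D f : open D -> smooth_on D f -> (forall T, D T -> f T != 0) ->
  smooth_on D (fun T => (f T)^-1).
Proof.
move=> oD sf f0.
pose C := [set h : time_space R -> R | exists2 u,
  smooth_on D u.1 & h = fun T => u.1 T * (f T)^-1 ^+ u.2].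
apply: (@smooth_class D C oD); last first.
- exists (cst 1, 1%N); first exact: smooth_cst.
  by apply/funext => T /=; rewrite mul1r expr1.
- move=> _ i [[u m] /= su ->].
  pose v (T : time_space R) := partial i u T * f T - m%:R * (u T * partial i f T).
  have sv : smooth_on D v.
    apply: smoothD; [exact: oD| |].
      by apply: (smoothM oD _ sf); exact: smooth_partial.
    apply: (smoothN oD); apply: (smoothM oD (smooth_cst m%:R oD)).
    by apply: (smoothM oD su); exact: smooth_partial.
  exists (fun T => v T * (f T)^-1 ^+ m.+1); split.
    by exists (v, m.+1); first exact: sv.
  move=> T DT.
  have dV : is_derive (T i) 1 (fun x => (slice f i T x)^-1)
      (- (f T) ^- 2 *: partial i f T).
    have [df dE] := smooth_is_derive i sf DT.
    have fT0 : slice f i T (T i) != 0 by rewrite /slice dfwith_self f0.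
    apply: DeriveDef; first exact: derivableV fT0 df.
    by rewrite (deriveV fT0 df) dE /slice dfwith_self.
  have powE (w : R -> R) j x : (w ^+ j) x = w x ^+ j.
    by elim: j => [|j IH]; rewrite ?expr0 // !exprS -IH.
  have -> : slice (fun T => u T * (f T)^-1 ^+ m) i T =
      slice u i T * (fun x => (slice f i T x)^-1) ^+ m.
    apply/funext => x.
    by rewrite -[RHS]/(slice u i T x * ((fun x => (slice f i T x)^-1) ^+ m) x) powE.
  apply: is_derive_eq.
    exact: (is_deriveM (smooth_is_derive i su DT) (is_deriveX m dV)).
  rewrite /v /slice !powE !dfwith_self /GRing.scale /=.
  have := f0 T DT; move: (f T) (u T) (partial i u T) (partial i f T).
  move=> y a a' y' y0; case: {v sv} m => [|m] /=.
    by rewrite expr0 expr1 !mul0r mulr0 add0r mul1r subr0 mulfK.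
  by rewrite -exprVn !exprS; move: (y^-1 ^+ m) m.+1%:R => z c; field.
- move=> _ T [[u m] /= su ->] DT; apply: continuousM.
    exact: smooth_continuous su DT.
  elim: m => [|m IH].
    have -> : (fun x => (f x)^-1 ^+ 0) = cst 1 by apply/funext=> x; rewrite expr0.
    exact: cst_continuous.
  have -> : (fun x => (f x)^-1 ^+ m.+1) = fun x => (f x)^-1 * (f x)^-1 ^+ m.
    by apply/funext=> x; rewrite exprS.
  apply: continuousM => //; apply: continuousV; first exact: f0.
  exact: smooth_continuous sf DT.
Qed.

End PartialDerivatives.

Record domain (R : realType) := Domain {
  dom_set :> time_space R -> Prop;
  dom_open : open dom_set;
  dom_neq0 : dom_set !=set0 }.

(* Functions on the domain [D] are represented by functions on the whole space
   that vanish outside [D], so that Leibniz equality is equality on [D]. *)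
Record smooth_fun (R : realType) (D : domain R) := SmoothFun {
  fun_of_smooth :> time_space R -> R;
  smooth_funP : smooth_on D fun_of_smooth;
  smooth_fun_out : forall T, ~ D T -> fun_of_smooth T = 0 }.

Section SmoothFun.
Variables (R : realType) (D : domain R).
Local Notation A := (smooth_fun D).
Implicit Types f g h : A.

HB.instance Definition _ := gen_eqMixin A.
HB.instance Definition _ := gen_choiceMixin A.

Lemma smooth_eqP f g : (forall T, D T -> f T = g T) -> f = g.
Proof.
move=> fg; have : fun_of_smooth f = fun_of_smooth g.
  apply/funext => T; have [/fg//|nDT] := pselect (D T).
  by rewrite !smooth_fun_out.
case: f g {fg} => [f sf f0] [g sg g0] /= fg; subst g.
by congr SmoothFun; exact: Prop_irrelevance.
Qed.

Definition cut (u : time_space R -> R) : time_space R -> R := patch (cst 0) D u.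

Lemma cut_in u T : D T -> cut u T = u T.
Proof. by move=> DT; rewrite /cut patchT // inE. Qed.

Lemma cut_out u T : ~ D T -> cut u T = 0.
Proof. by move=> DT; rewrite /cut patchC // inE. Qed.

Lemma smooth_cut u : smooth_on D u -> smooth_on D (cut u).
Proof.
by apply: (eq_smooth (dom_open D)) => T; rewrite inE => DT; rewrite cut_in.
Qed.

Definition mk_smooth (u : time_space R -> R) (su : smooth_on D u) : A :=
  SmoothFun (smooth_cut su) (@cut_out u).

Lemma mk_smoothE u (su : smooth_on D u) T : D T -> mk_smooth su T = u T.
Proof. exact: cut_in. Qed.

Let oD := dom_open D.

Definition smooth_const c : A := mk_smooth (smooth_cst c oD).
Definition smooth_add f g : A :=
  mk_smooth (smoothD oD (smooth_funP f) (smooth_funP g)).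
Definition smooth_opp f : A := mk_smooth (smoothN oD (smooth_funP f)).
Definition smooth_mul f g : A :=
  mk_smooth (smoothM oD (smooth_funP f) (smooth_funP g)).

Definition nowhere0 f : Prop := forall T, D T -> f T != 0.

Definition smooth_inv f : A :=
  if pselect (nowhere0 f) is left f0
  then mk_smooth (smoothV oD (smooth_funP f) f0) else f.

Let addA : associative smooth_add.
Proof. by move=> f g h; apply: smooth_eqP => T DT; rewrite !mk_smoothE // addrA. Qed.
Let addC : commutative smooth_add.
Proof. by move=> f g; apply: smooth_eqP => T DT; rewrite !mk_smoothE // addrC. Qed.
Let add0 : left_id (smooth_const 0) smooth_add.
Proof. by move=> f; apply: smooth_eqP => T DT; rewrite !mk_smoothE // add0r. Qed.
Let addN : left_inverse (smooth_const 0) smooth_opp smooth_add.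
Proof. by move=> f; apply: smooth_eqP => T DT; rewrite !mk_smoothE // addNr. Qed.

HB.instance Definition _ := GRing.isZmodule.Build A addA addC add0 addN.

Let mulA : associative smooth_mul.
Proof. by move=> f g h; apply: smooth_eqP => T DT; rewrite !mk_smoothE // mulrA. Qed.
Let mulC : commutative smooth_mul.
Proof. by move=> f g; apply: smooth_eqP => T DT; rewrite !mk_smoothE // mulrC. Qed.
Let mul1 : left_id (smooth_const 1) smooth_mul.
Proof. by move=> f; apply: smooth_eqP => T DT; rewrite !mk_smoothE // mul1r. Qed.
Let mulD : left_distributive smooth_mul smooth_add.
Proof. by move=> f g h; apply: smooth_eqP => T DT; rewrite !mk_smoothE // mulrDl. Qed.
Let one_neq0 : smooth_const 1 != smooth_const 0.
Proof.
apply/eqP => e10; have [T DT] := dom_neq0 D.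
have : smooth_const 1 T = smooth_const 0 T by rewrite e10.
by rewrite !mk_smoothE // => /eqP; rewrite oner_eq0.
Qed.

HB.instance Definition _ :=
  GRing.Zmodule_isComNzRing.Build A mulA mulC mul1 mulD one_neq0.

Let unit : {pred A} := fun f => `[< nowhere0 f >].
Let mulV : {in unit, left_inverse 1 smooth_inv *%R}.
Proof.
move=> f /asboolP f0; rewrite /smooth_inv; case: pselect => // f0'.
by apply: smooth_eqP => T DT; rewrite !mk_smoothE //= mulVf // f0.
Qed.
Let unitPl f g : g * f = 1 -> unit f.
Proof.
move=> gf1; apply/asboolP => T DT; apply/eqP => fT0.
have e : smooth_mul g f = smooth_const 1 := gf1.
have : smooth_mul g f T = smooth_const 1 T by rewrite e.
by rewrite !mk_smoothE // fT0 mulr0 => /eqP; rewrite eq_sym oner_eq0.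
Qed.
Let invr_out : {in [predC unit], smooth_inv =1 id}.
Proof.
by move=> f /asboolPn nf0; rewrite /smooth_inv; case: pselect.
Qed.

HB.instance Definition _ :=
  GRing.ComNzRing_hasMulInverse.Build A mulV unitPl invr_out.

Lemma smooth_unitE f : (f \is a GRing.unit) <-> nowhere0 f.
Proof. by split=> /asboolP. Qed.

(* [dT j f] is the derivative of [f] with respect to T_j, for j >= 1. *)
Definition dT (j : nat) f : A :=
  mk_smooth (smooth_partial j.-1 (smooth_funP f)).

End SmoothFun.

Lemma smooth_natE (R : realType) (D : domain R) n T : D T ->
  (n%:R : smooth_fun D) T = n%:R.
Proof.
move=> DT; elim: n => [|n IH]; first exact: mk_smoothE.
rewrite -addn1 natrD [in RHS]natrD -IH; rewrite [LHS]mk_smoothE //.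
by congr (_ + _); exact: mk_smoothE.
Qed.

Lemma smooth_natr_unit (R : realType) (D : domain R) n :
  (n.+1%:R : smooth_fun D) \is a GRing.unit.
Proof. by apply/smooth_unitE => T DT; rewrite smooth_natE // pnatr_eq0. Qed.

(* Formal Laurent series in p^-1; [S j] is the coefficient of p^j. *)
Record laurent (A : comNzRingType) := Laurent {
  coef_of :> int -> A;
  laurentP : exists d : int, forall j, d < j -> coef_of j = 0 }.

Section LaurentRing.
Variable A : comNzRingType.
Local Notation L := (laurent A).
Implicit Types (S U V : L) (d m : int).

HB.instance Definition _ := gen_eqMixin L.
HB.instance Definition _ := gen_choiceMixin L.

Lemma laurent_eqP S U : (forall j, S j = U j) -> S = U.
Proof.
case: S U => [s sb] [u ub] /= su.
have {}su : s = u by apply/funext.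
by subst u; congr Laurent; exact: Prop_irrelevance.
Qed.

Definition bounded_by (s : int -> A) d := forall j, d < j -> s j = 0.

Lemma lconst_bounded (a : A) :
  exists d, bounded_by (fun j => if j == 0 then a else 0) d.
Proof. by exists 0 => j j0; rewrite gt_eqF. Qed.
Definition lconst a : L := Laurent (lconst_bounded a).

Lemma ladd_bounded S U : exists d, bounded_by (fun j => S j + U j) d.
Proof.
have [[d Sd] [e Ue]] := (laurentP S, laurentP U).
exists (Num.max d e) => j; rewrite gt_max => /andP[dj ej].
by rewrite Sd // Ue // addr0.
Qed.
Definition ladd S U : L := Laurent (ladd_bounded S U).

Lemma lopp_bounded S : exists d, bounded_by (fun j => - S j) d.
Proof. by have [d Sd] := laurentP S; exists d => j /Sd ->; rewrite oppr0. Qed.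
Definition lopp S : L := Laurent (lopp_bounded S).

(* Only finitely many terms of this sum are nonzero. *)
Definition lmul_coef (s u : int -> A) (m : int) : A :=
  \sum_(i \in [set: int]) s i * u (m - i).

Lemma lmul_coef_bounded s u d e : bounded_by s d -> bounded_by u e ->
  bounded_by (lmul_coef s u) (d + e).
Proof.
move=> sd ue m dem; rewrite /lmul_coef fsbig1 // => i _.
have [id|di] := leP i d; last by rewrite sd // mul0r.
by rewrite ue ?mulr0 //; lia.
Qed.

Lemma lmul_bounded S U : exists d, bounded_by (lmul_coef S U) d.
Proof.
have [[d Sd] [e Ue]] := (laurentP S, laurentP U).
by exists (d + e); exact: lmul_coef_bounded.
Qed.
Definition lmul S U : L := Laurent (lmul_bounded S U).

Lemma lmul_coefE s u d e (n : nat) : bounded_by s d -> bounded_by u e ->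
  lmul_coef s u (d + e - n%:Z) =
  \sum_(i < n.+1) s (d - i%:Z) * u (e - (n - i)%N%:Z).
Proof.
move=> sd ue; rewrite /lmul_coef.
rewrite -(fsbig_widen ((fun i : nat => d - i%:Z) @` `I_n.+1) setT) //.
  rewrite fsbig_image; last by move=> i j _ _ ?; lia.
  rewrite -(@fsbig_ord _ _ _ n.+1
    (fun i => s (d - i%:Z) * u (d + e - n%:Z - (d - i%:Z)))).
  apply: eq_bigr => i _; congr (_ * u _).
  by have := ltn_ord i; lia.
move=> i [_ /= ni]; have [id|di] := leP i d; last by rewrite sd // mul0r.
rewrite ue ?mulr0 // ltNge; apply/negP => ie; apply: ni.
by exists `|d - i|%N; lia.
Qed.

Lemma lmulE S U d e : bounded_by S d -> bounded_by U e ->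
  forall N n, (n < N)%N -> lmul S U (d + e - n%:Z) =
  ((\poly_(i < N) S (d - i%:Z)) * (\poly_(i < N) U (e - i%:Z)))`_n.
Proof.
move=> Sd Ue N n nN; rewrite [LHS]lmul_coefE // coefM.
apply: eq_bigr => i _; have := ltn_ord i => iN.
by rewrite !coef_poly !ifT //; lia.
Qed.

Lemma bounded_eqP S U d : bounded_by S d -> bounded_by U d ->
  (forall n : nat, S (d - n%:Z) = U (d - n%:Z)) -> S = U.
Proof.
move=> Sd Ud SU; apply: laurent_eqP => j.
have [jd|dj] := leP j d; last by rewrite Sd // Ud.
have -> : j = d - `|d - j|%N%:Z by lia.
exact: SU.
Qed.

Let addA : associative ladd.
Proof. by move=> S U V; apply: laurent_eqP => j; rewrite /= addrA. Qed.
Let addC : commutative ladd.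
Proof. by move=> S U; apply: laurent_eqP => j; rewrite /= addrC. Qed.
Let add0 : left_id (lconst 0) ladd.
Proof. by move=> S; apply: laurent_eqP => j; rewrite /= if_same add0r. Qed.
Let addN : left_inverse (lconst 0) lopp ladd.
Proof. by move=> S; apply: laurent_eqP => j; rewrite /= if_same addNr. Qed.

HB.instance Definition _ := GRing.isZmodule.Build L addA addC add0 addN.

Let mulC : commutative lmul.
Proof.
move=> S U; have [[d Sd] [e Ue]] := (laurentP S, laurentP U).
apply: (@bounded_eqP _ _ (d + e)).
- exact: lmul_coef_bounded.
- by rewrite addrC; exact: lmul_coef_bounded.
- move=> n; rewrite (lmulE Sd Ue (ltnSn n)) [d + e]addrC.
  by rewrite (lmulE Ue Sd (ltnSn n)) mulrC.
Qed.

Let mulA : associative lmul.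
Proof.
move=> S U V; apply: esym.
have [[[d Sd] [e Ue]] [c Vc]] := (laurentP S, laurentP U, laurentP V).
have SUb : bounded_by (lmul S U) (d + e) by exact: lmul_coef_bounded.
have UVb : bounded_by (lmul U V) (e + c) by exact: lmul_coef_bounded.
apply: (@bounded_eqP _ _ (d + e + c)).
- exact: lmul_coef_bounded.
- by rewrite -addrA; exact: lmul_coef_bounded.
- move=> n.
  rewrite (lmulE SUb Vc (ltnSn n)) -[d + e + c]addrA (lmulE Sd UVb (ltnSn n)).
  set PS := \poly_(i < n.+1) S _; set PU := \poly_(i < n.+1) U (e - i%:Z).
  set PV := \poly_(i < n.+1) V (c - i%:Z).
  transitivity ((PS * (PU * PV))`_n); [rewrite mulrA|]; rewrite !coefM.
    apply: eq_bigr => i _; congr (_ * _).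
    by rewrite coef_poly ltn_ord (lmulE Sd Ue (N := n.+1)).
  apply: eq_bigr => i _; congr (_ * _); rewrite coef_poly ifT; last by lia.
  by rewrite (lmulE Ue Vc (N := n.+1)) //; lia.
Qed.

Let mul1 : left_id (lconst 1) lmul.
Proof.
move=> S; apply: laurent_eqP => j; rewrite /= /lmul_coef.
rewrite -(fsbig_widen [set 0] setT) //; last first.
  by move=> i [_ /eqP /negbTE i0] /=; rewrite i0 mul0r.
by rewrite fsbig_set1 /= mul1r subr0.
Qed.

Let mulD : left_distributive lmul ladd.
Proof.
move=> S U V.
have [[[d0 Sd0] [e0 Ue0]] [c Vc]] := (laurentP S, laurentP U, laurentP V).
pose d := Num.max d0 e0.
have Sd : bounded_by S d by move=> j; rewrite gt_max => /andP[/Sd0].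
have Ud : bounded_by U d by move=> j; rewrite gt_max => /andP[_ /Ue0].
have SUd : bounded_by (ladd S U) d by move=> j dj; rewrite /= Sd // Ud // addr0.
have SVd : bounded_by (lmul S V) (d + c) by exact: lmul_coef_bounded.
have UVd : bounded_by (lmul U V) (d + c) by exact: lmul_coef_bounded.
apply: (@bounded_eqP _ _ (d + c)).
- exact: lmul_coef_bounded.
- move=> j dj; rewrite [LHS]/(lmul S V j + lmul U V j).
  by rewrite SVd // UVd //; exact: addr0.
- move=> n.
  transitivity (lmul_coef S V (d + c - n%:Z) + lmul_coef U V (d + c - n%:Z)).
    rewrite [LHS](lmul_coefE n SUd Vc) (lmul_coefE n Sd Vc).
    rewrite (lmul_coefE n Ud Vc) -big_split.
    by apply: eq_bigr => i _; exact: mulrDl.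
  by [].
Qed.

Let one_neq0 : lconst 1 != lconst 0.
Proof.
apply/eqP => /(congr1 (fun S : L => S 0)) /= /eqP.
by rewrite oner_eq0.
Qed.

HB.instance Definition _ :=
  GRing.Zmodule_isComNzRing.Build L mulA mulC mul1 mulD one_neq0.

(* A_{>= r} *)
Lemma lge_bounded (r : int) S :
  exists d, bounded_by (fun j => if r <= j then S j else 0) d.
Proof. by have [d Sd] := laurentP S; exists d => j /Sd ->; rewrite if_same. Qed.
Definition lge r S : L := Laurent (lge_bounded r S).

Lemma dp_bounded S : exists d, bounded_by (fun j => S (j + 1) *~ (j + 1)) d.
Proof.
have [d Sd] := laurentP S; exists d => j dj.
by rewrite Sd ?mul0rz //; lia.
Qed.
Definition dp S : L := Laurent (dp_bounded S).

Lemma geom_bounded (b : A) :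
  exists d, bounded_by (fun j => if j is Negz i then b ^+ i else 0) d.
Proof. by exists 0; case. Qed.
(* 1 / (p - b) = sum_i b^i p^(- i - 1), and [Negz i] is - i - 1 *)
Definition inv_p_minus b : L := Laurent (geom_bounded b).

(* Value at p = b of a series without negative powers of p. *)
Definition leval S (b : A) : A := \sum_(i \in [set: nat]) S i%:Z * b ^+ i.

Definition monic_of_degree (n : nat) S : Prop :=
  S n%:Z = 1 /\ forall j : int, n%:Z < j -> S j = 0.

(* M^(1/n). If n is invertible in A and M is monic of degree n, there is exactly
   one such S, so the default value 0 is not used. *)
Definition lroot (n : nat) (M : L) : L :=
  xget 0 [set S | monic_of_degree 1 S /\ S ^+ n = M].

End LaurentRing.

Lemma dT0 (R : realType) (D : domain R) j : dT j (0 : smooth_fun D) = 0.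
Proof.
apply: smooth_eqP => T DT; rewrite !mk_smoothE //.
rewrite (eq_partial (g := cst 0) _ (dom_open D) DT); last first.
  by move=> U; rewrite inE => DU; rewrite mk_smoothE.
by rewrite /partial /slice derive1_cst.
Qed.

Section Hierarchy.
Variables (R : realType) (D : domain R).
Local Notation A := (smooth_fun D).
Implicit Types (S U M : laurent A) (phi : A).

Lemma ldT_bounded j S : exists d, bounded_by (fun i => dT j (S i)) d.
Proof. by have [d Sd] := laurentP S; exists d => i /Sd ->; exact: dT0. Qed.
Definition ldT j S : laurent A := Laurent (ldT_bounded j S).

Definition poisson S U : laurent A := dp S * ldT 1 U - ldT 1 S * dp U.

Lemma exp_neg_ad_bounded phi S : exists d, bounded_by (fun m : int =>
  \sum_(l \in [set: nat])
     (-1) ^+ l / l`!%:R * iter l (poisson (lconst phi)) S m) d.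
Proof.
have [d Sd] := laurentP S; exists d => m dm; rewrite fsbig1 // => l _.
suff: bounded_by (iter l (poisson (lconst phi)) S) d by move=> ->; rewrite ?mulr0.
have dp0 : dp (lconst phi) = 0.
  apply: laurent_eqP => j /=; rewrite if_same.
  by case: eqP => [->|_]; rewrite ?mulr0z ?mul0rz.
have ld0 : bounded_by (ldT 1 (lconst phi)) 0.
  by move=> j j0 /=; rewrite gt_eqF // dT0.
have poissonE U : poisson (lconst phi) U = - (ldT 1 (lconst phi) * dp U).
  by rewrite /poisson dp0 mul0r sub0r.
elim: l => [|l IH]; first exact: Sd.
rewrite iterS poissonE; set U := iter l _ S in IH *.
have dpd : bounded_by (dp U) d.
  by move=> j dj /=; rewrite IH ?mul0rz //; lia.
have ld : bounded_by (ldT 1 (lconst phi) * dp U) d.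
  by rewrite -[d]add0r; exact: lmul_coef_bounded.
move=> j dj; transitivity (- (ldT 1 (lconst phi) * dp U) j); first by [].
by rewrite ld // oppr0.
Qed.
(* e^(- ad phi); for each power of p only finitely many terms are nonzero. *)
Definition exp_neg_ad phi S : laurent A := Laurent (exp_neg_ad_bounded phi S).

(* [(L^n)^(k/n)]_{>= 1}, for M = L^n *)
Definition Qpart (k n : nat) M : laurent A := lge 1 (lroot n M ^+ k).

Definition source_terms (N : nat) (a p : 'I_N -> A) : laurent A :=
  \sum_i (lconst (a i / p i) + lconst (a i) * inv_p_minus (p i)).

(* The dispersionless mKP hierarchy with self-consistent sources, for
   M = L^n. *)
Definition dmKPSCS (k n N : nat) M (a p : 'I_N -> A) : Prop :=
  let Qk := Qpart k n M in
  ldT n Qk - ldT k M + poisson Qk M = 0 /\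
  forall i : 'I_N,
    dT k (a i) = dT 1 (a i * leval (dp Qk) (p i)) /\
    dT k (p i) = dT 1 (leval Qk (p i)).

End Hierarchy.

(* Main.v *)
Require Import Defs.
From HB Require Import structures.
From mathcomp Require Import all_boot all_order all_algebra.
From mathcomp Require Import all_classical all_reals all_analysis.
From mathcomp Require Import zify ring lra.

(* The operator E = exp (- ad phi) is the substitution p -> p + phi_X: it is a
   ring morphism of Laurent series that commutes with d/dp, maps
   1 / (p - b) to 1 / (p - (b - phi_X)), and satisfies
   (E S)_(T_j) = E (S_(T_j)) + phi_(X T_j) E (S_p).  Since E only adds terms of
   lower degree, (E S)_(>= 1) is E (S_(>= 1)) minus its constant term
   S_(>= 1)(phi_X).  Hence the transformed L^n equals E (L^n) - phi_(T_n).
   Subtracting a function of T changes the n-th root only in degrees <= 1 - n,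
   so its k-th power, k < n, is unchanged in degrees >= 0, and the transformed
   Q_k is E Q_k - phi_(T_k).  In the zero curvature equation the extra terms
   cancel by equality of mixed partial derivatives, and the source equations
   follow because evaluating E S at p_i - phi_X is evaluating S at p_i. *)

Set Implicit Arguments.
Unset Strict Implicit.
Unset Printing Implicit Defensive.

Import Order.TTheory GRing.Theory Num.Theory.
Import numFieldNormedType.Exports.

Local Open Scope ring_scope.

(** * Equality of mixed partial derivatives *)

Section MixedPartials.
Local Open Scope classical_set_scope.
Variable R : realType.

(** Two uses of the mean value theorem: first in [s], for the increment of [g s] between [y] and
    [y + h], then in the second variable, for [g1 s] at the point [s] so found. *)
Lemma second_difference_MVT (g g1 g12 : R -> R -> R) (x y h : R) : 0 < h ->
  (forall s t : R, x <= s <= x + h -> y <= t <= y + h ->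
     is_derive s 1 (fun s => g s t) (g1 s t)) ->
  (forall s t : R, x <= s <= x + h -> y <= t <= y + h ->
     is_derive t 1 (g1 s) (g12 s t)) ->
  exists s t : R, [/\ x <= s <= x + h, y <= t <= y + h &
    g (x + h) (y + h) - g (x + h) y - (g x (y + h) - g x y)
      = g12 s t * h * h].
Proof.
move=> h0 d1 d2.
have xh : x < x + h by rewrite ltrDl.
have yh : y < y + h by rewrite ltrDl.
have ey : y <= y <= y + h by rewrite lexx ltW.
have eyh : y <= y + h <= y + h by rewrite lexx andbT ltW.
pose F s := g s (y + h) - g s y.
have dF s : x <= s <= x + h -> is_derive s 1 F (g1 s (y + h) - g1 s y).
  by move=> xs; exact: (is_deriveB (d1 _ _ xs eyh) (d1 _ _ xs ey)).
have [s sx FE] : exists2 s, s \in `]x, x + h[%R &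
    F (x + h) - F x = (g1 s (y + h) - g1 s y) * (x + h - x).
  apply: (MVT xh) => [s|].
    by rewrite in_itv /= => /andP[s1 s2]; apply: dF; rewrite !ltW.
  apply: derivable_within_continuous => s; rewrite in_itv /= => xs.
  by have [] := dF _ xs.
have {}sx : x <= s <= x + h.
  by move: sx; rewrite in_itv /= => /andP[s1 s2]; rewrite !ltW.
have [t ty gE] : exists2 t, t \in `]y, y + h[%R &
    g1 s (y + h) - g1 s y = g12 s t * (y + h - y).
  apply: (MVT yh) => [t|].
    by rewrite in_itv /= => /andP[t1 t2]; apply: d2 => //; rewrite !ltW.
  apply: derivable_within_continuous => t; rewrite in_itv /= => yt.
  by have [] := d2 _ _ sx yt.
exists s, t; split=> //.
  by move: ty; rewrite in_itv /= => /andP[t1 t2]; rewrite !ltW.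
rewrite -/(F (x + h)) -/(F x) FE gE.
by ring.
Qed.

(** Convergence in the product topology is tested coordinate by coordinate. This is what puts small
    squares in the coordinates [i] and [j] inside a given neighbourhood of [T]. *)
Lemma cvg_dfwith2 (T : time_space R) i j : i != j ->
  (fun z : R * R => dfwith (dfwith T i z.1) j z.2 : time_space R) @
    (nbhs (T i, T j)) --> T.
Proof.
move=> ij; apply/cvg_sup => l.
apply/cvg_image.
  by rewrite eqEsubset; split=> // r _; exists (dfwith T l r) => //; rewrite dfwithin.
move=> B TlB; exists (@proj nat (fun=> R) l @^-1` B); last first.
  rewrite eqEsubset; split=> [_ [U BU <-]//|r Br].
  by exists (dfwith T l r); rewrite /= /proj dfwithin.
rewrite /= nbhs_simpl /= /proj.
(* Coordinates [i] and [j] are the two projections of [z]; every other coordinate stays equal to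
   [T l]. *)
have [li|il] := eqVneq l i; last have [lj|jl] := eqVneq l j.
- subst l; have : (fun z : R * R => z.1) @ (nbhs (T i, T j)) --> T i by exact: cvg_fst.
  move=> /(_ _ TlB) H; apply: (@filterS _ _ (nbhs_filter (T i, T j)) _ _ _ H) => z /= Bz.
  by rewrite dfwithout 1?eq_sym // dfwithin.
- subst l; have : (fun z : R * R => z.2) @ (nbhs (T i, T j)) --> T j by exact: cvg_snd.
  move=> /(_ _ TlB) H; apply: (@filterS _ _ (nbhs_filter (T i, T j)) _ _ _ H) => z /= Bz.
  by rewrite dfwithin.
- apply: (@filterE _ _ (nbhs_filter (T i, T j))) => z /=; rewrite !dfwithout 1?eq_sym //.
  exact: nbhs_singleton TlB.
Qed.

Lemma dfwithC (T : time_space R) i j (x y : R) : i != j ->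
  dfwith (dfwith T i x) j y = dfwith (dfwith T j y) i x.
Proof.
move=> ij; apply/funext => l.
have [<-|li] := eqVneq i l.
  by rewrite dfwithin dfwithout 1?eq_sym // dfwithin.
have [<-|lj] := eqVneq j l; first by rewrite dfwithin dfwithout // dfwithin.
by rewrite !dfwithout.
Qed.

Lemma dfwith_idem (T : time_space R) i (x y : R) :
  dfwith (dfwith T i x) i y = dfwith T i y.
Proof.
apply/funext => l; have [<-|li] := eqVneq i l; first by rewrite !dfwithin.
by rewrite !dfwithout.
Qed.

(** Slices of [f] through points of the square are sections of a function of two real variables, so
    [second_difference_MVT] applies; the square must lie in [D], where [f] is differentiable. *)
Lemma mixed_difference (D : set (time_space R)) f i j (T : time_space R) (h : R) :
  i != j -> smooth_on D f -> 0 < h ->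
  (forall x y : R, T i <= x <= T i + h -> T j <= y <= T j + h ->
     D (dfwith (dfwith T i x) j y)) ->
  exists x y : R, [/\ T i <= x <= T i + h, T j <= y <= T j + h &
    let g x y := f (dfwith (dfwith T i x) j y) in
    g (T i + h) (T j + h) - g (T i + h) (T j)
      - (g (T i) (T j + h) - g (T i) (T j))
    = partial j (partial i f) (dfwith (dfwith T i x) j y) * h * h].
Proof.
move=> ij sf h0 box; have ji : j != i by rewrite eq_sym.
apply: (@second_difference_MVT
  (fun x y => f (dfwith (dfwith T i x) j y))
  (fun x y => partial i f (dfwith (dfwith T i x) j y))
  (fun x y => partial j (partial i f) (dfwith (dfwith T i x) j y))
  (T i) (T j) h h0) => x y xi yj.
- have sE : slice f i (dfwith (dfwith T i x) j y) =
      fun s => f (dfwith (dfwith T i s) j y).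
    by apply/funext => s; rewrite /slice dfwithC // dfwith_idem.
  have xE : dfwith (dfwith T i x) j y i = x by rewrite dfwithout // dfwithin.
  by have := smooth_is_derive i sf (box _ _ xi yj); rewrite sE xE.
- have sE : slice (partial i f) j (dfwith (dfwith T i x) j y) =
      fun s => partial i f (dfwith (dfwith T i x) j s).
    by apply/funext => s; rewrite /slice dfwith_idem.
  have yE : dfwith (dfwith T i x) j y j = y by rewrite dfwithin.
  by have := smooth_is_derive j (@smooth_partial _ _ _ i sf) (box _ _ xi yj);
    rewrite sE yE.
Qed.

(* Clairaut: both second derivatives compute the same second difference. *)
Lemma partialC (D : set (time_space R)) f i j T : open D -> smooth_on D f ->
  D T -> partial i (partial j f) T = partial j (partial i f) T.
Proof.
move=> oD sf DT; have [->//|ij] := eqVneq i j.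
(* Every neighbourhood of [T] contains two points at which the two mixed derivatives take a common
   value; continuity at [T] then gives equality there. *)
have close (W : set (time_space R)) : nbhs T W -> exists U V,
    [/\ W U, W V & partial i (partial j f) U = partial j (partial i f) V].
  move=> TW.
  have : nbhs T (W `&` D) by apply: filterI => //; exact: open_nbhs_nbhs.
  move=> /(cvg_dfwith2 ij) /= [[U V] /= [TU TV] UV].
  have /nbhs_ballP[c /= c0 cU] := TU; have /nbhs_ballP[d /= d0 dV] := TV.
  (* Half the smaller radius keeps the closed square of side [h] inside the product of the two open
     balls. *)
  pose h := Num.min c d / 2.
  have h0 : 0 < h by rewrite divr_gt0 // lt_min c0 d0.
  have [hc hd] : h < c /\ h < d.
    have : Num.min c d <= c by rewrite ge_min lexx.
    have : Num.min c d <= d by rewrite ge_min lexx orbT.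
    by move: h0; rewrite /h; move: (Num.min c d) => m; split; lra.
  have box (x y : R) : T i <= x <= T i + h -> T j <= y <= T j + h ->
      (W `&` D) (dfwith (dfwith T i x) j y).
    move=> /andP[xi1 xi2] /andP[yj1 yj2]; apply: (UV (x, y)); split=> /=.
      by apply: cU; rewrite /ball /= ltr_norml; apply/andP; split; lra.
    by apply: dV; rewrite /ball /= ltr_norml; apply/andP; split; lra.
  have [x [y [xi yj E]]] := mixed_difference ij sf h0
    (fun x y xi yj => (box x y xi yj).2).
  have ji : j != i by rewrite eq_sym.
  have box' (y1 x1 : R) : T j <= y1 <= T j + h -> T i <= x1 <= T i + h ->
      (W `&` D) (dfwith (dfwith T j y1) i x1).
    by move=> y1j x1i; rewrite dfwithC //; exact: box.
  have boxD' (y1 x1 : R) : T j <= y1 <= T j + h -> T i <= x1 <= T i + h ->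
      D (dfwith (dfwith T j y1) i x1).
    by move=> y1j x1i; exact: (box' _ _ y1j x1i).2.
  have [y' [x' [yj' xi' E']]] := mixed_difference ji sf h0 boxD'.
  exists (dfwith (dfwith T j y') i x'), (dfwith (dfwith T i x) j y); split.
  - exact: (box' _ _ yj' xi').1.
  - exact: (box _ _ xi yj).1.
  (* Both derivatives, times [h] twice, equal the same second difference, up to the order in which
     the coordinates are set. *)
  - apply: (mulIf (lt0r_neq0 h0)); apply: (mulIf (lt0r_neq0 h0)).
    have fC y1 x1 : f (dfwith (dfwith T j y1) i x1) =
        f (dfwith (dfwith T i x1) j y1) by rewrite dfwithC.
    apply: etrans (esym E') (etrans _ E); rewrite /= !fC.
    by ring.
have su : smooth_on D (partial i (partial j f)) by do 2 apply: smooth_partial.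
have sv : smooth_on D (partial j (partial i f)) by do 2 apply: smooth_partial.
move: close su sv.
move: (partial i (partial j f)) (partial j (partial i f)) => u v close su sv.
(* If the values at [T] differed, each function would stay within half their distance of its own
   value near [T], which the triangle inequality forbids for a common value. *)
apply/eqP/negPn/negP => uv.
have e0 : 0 < `|u T - v T| / 2 by rewrite divr_gt0 // normr_gt0 subr_eq0.
have /cvgrPdist_lt /(_ _ e0) nu := smooth_continuous su DT.
have /cvgrPdist_lt /(_ _ e0) nv := smooth_continuous sv DT.
have [U [V [[uU _] [_ vV] E]]] := close _ (filterI nu nv).
move: uU vV; rewrite /= E => uU vV.
move: uU vV e0 (ler_distD (v V) (u T) (v T)); rewrite [`|v V - v T|]distrC.
move: `|u T - v T| `|u T - v V| `|v T - v V| => a b c; lra.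
Qed.

Lemma dTC (D : domain R) i j (f : smooth_fun D) : dT i (dT j f) = dT j (dT i f).
Proof.
have dTE k (g : smooth_fun D) T : D T -> dT k g T = partial k.-1 g T.
  exact: mk_smoothE.
have partial_dT k l T : D T ->
    partial k (dT l f) T = partial k (partial l.-1 f) T.
  move=> DT; apply: (eq_partial _ (dom_open D) DT) => U; rewrite inE => DU.
  exact: dTE.
apply: smooth_eqP => T DT.
transitivity (partial i.-1 (partial j.-1 f) T).
  exact: etrans (dTE _ _ _ DT) (partial_dT _ _ _ DT).
rewrite (partialC _ _ (dom_open D) (smooth_funP f) DT).
exact: esym (etrans (dTE _ _ _ DT) (partial_dT _ _ _ DT)).
Qed.

End MixedPartials.

(** * Laurent series *)

Section LaurentSeries.
Variable A : comNzRingType.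
Local Notation L := (laurent A).
Implicit Types (S U V W : L) (c b : A) (d e : int).

Lemma laurent0E j : (0 : L) j = 0.
Proof. by rewrite [LHS]/= if_same. Qed.

Lemma laurentDE S U j : (S + U) j = S j + U j.
Proof. by []. Qed.

Lemma laurentBE S U j : (S - U) j = S j - U j.
Proof. by []. Qed.

Lemma laurent_sumE I (r : seq I) (P : pred I) (F : I -> L) j :
  (\sum_(i <- r | P i) F i) j = \sum_(i <- r | P i) F i j.
Proof.
by elim/big_rec2: _ => [|i x S _ <-]; [exact: laurent0E|].
Qed.

Lemma bounded_le d e S : d <= e -> bounded_by S d -> bounded_by S e.
Proof. by move=> de Sd j ej; apply: Sd; apply: le_lt_trans de ej. Qed.

Lemma boundedD d S U : bounded_by S d -> bounded_by U d -> bounded_by (S + U) d.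
Proof. by move=> Sd Ud j dj; rewrite laurentDE Sd // Ud // addr0. Qed.

Lemma boundedN d S : bounded_by S d -> bounded_by (- S) d.
Proof. by move=> Sd j dj; rewrite [LHS]/= Sd // oppr0. Qed.

Lemma boundedB d S U : bounded_by S d -> bounded_by U d -> bounded_by (S - U) d.
Proof. by move=> Sd Ud; apply: boundedD => //; apply: boundedN. Qed.

Lemma boundedM d e S U :
  bounded_by S d -> bounded_by U e -> bounded_by (S * U) (d + e).
Proof. exact: lmul_coef_bounded. Qed.

Lemma bounded_sum d I (r : seq I) (P : pred I) (F : I -> L) :
  (forall i, P i -> bounded_by (F i) d) ->
  bounded_by (\sum_(i <- r | P i) F i) d.
Proof.
by move=> Fd j dj; rewrite laurent_sumE big1 // => i Pi; exact: Fd.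
Qed.

(** Serves to prove identities of series by successive approximation: the degree of the difference
    is made arbitrarily low. *)
Lemma bounded_eq0 d S : (forall m : nat, bounded_by S (d - m%:Z)) -> S = 0.
Proof.
move=> Sb; apply: laurent_eqP => j; rewrite laurent0E.
by apply: (Sb (`|d - j|.+1)%N); lia.
Qed.

Lemma boundedP d S : bounded_by S (d + 1) -> S (d + 1) = 0 -> bounded_by S d.
Proof.
move=> Sd Sd0 j dj; have [->//|jd] := eqVneq j (d + 1).
by apply: Sd; lia.
Qed.

Lemma lead_coefM d e S U : bounded_by S d -> bounded_by U e ->
  (S * U) (d + e) = S d * U e.
Proof.
move=> Sd Ue; have := lmul_coefE 0 Sd Ue.
by rewrite big_ord1 !subr0 => <-.
Qed.

(** The degree bound of [V] is lowered one step at a time: while it exceeds [d], the top coefficient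
    of [V] times the regular element [W e] is a coefficient of [V * W] that vanishes. *)
Lemma bounded_cancel d e V W : bounded_by W e -> GRing.rreg (W e) ->
  bounded_by (V * W) (d + e) -> bounded_by V d.
Proof.
move=> We regW VWb; have [c Vc] := laurentP V.
have [m Vm] : exists m : nat, bounded_by V (d + m%:Z).
  by exists `|c - d|%N; apply: bounded_le Vc; lia.
elim: m Vm => [|m IH Vm]; first by rewrite addr0.
apply: IH; apply: boundedP; first by apply: bounded_le Vm; lia.
rewrite (_ : d + m%:Z + 1 = d + m.+1%:Z); last by lia.
apply: regW; rewrite -(lead_coefM Vm We) VWb; last by lia.
by rewrite mul0r.
Qed.

(** The monomial c p^d, closed by [Defined] so that its coefficients compute. *)
Definition lmono c d : L.
refine (@Laurent _ (fun j => if j == d then c else 0) _).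
by exists d => j dj; rewrite gt_eqF.
Defined.

Lemma lmono_bounded c d : bounded_by (lmono c d) d.
Proof. by move=> j dj /=; rewrite gt_eqF. Qed.

Lemma lmonoM c d S j : (lmono c d * S) j = c * S (j - d).
Proof.
rewrite [LHS]/= /lmul_coef -(fsbig_widen [set d]%classic setT) //; last first.
  by move=> i [_ /= /eqP /negbTE id]; rewrite /= id mul0r.
by rewrite fsbig_set1 /= eqxx.
Qed.

Lemma lconst_lmono c : lconst c = lmono c 0.
Proof. exact: laurent_eqP. Qed.

Lemma lconst_mulE c S j : (lconst c * S) j = c * S j.
Proof. by rewrite lconst_lmono lmonoM subr0. Qed.

Lemma lconst_bounded0 c : bounded_by (lconst c) 0.
Proof. by rewrite lconst_lmono; exact: lmono_bounded. Qed.

Lemma lconst_is_zmod_morphism : zmod_morphism (@lconst A).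
Proof.
move=> c b; apply: laurent_eqP => j.
by rewrite laurentBE /=; case: eqP => // _; rewrite subr0.
Qed.

Lemma lconst_is_monoid_morphism : monoid_morphism (@lconst A).
Proof.
split=> // c b; apply: laurent_eqP => j; rewrite lconst_mulE /=.
by case: eqP => // _; rewrite mulr0.
Qed.

HB.instance Definition _ :=
  GRing.isZmodMorphism.Build A L (@lconst A) lconst_is_zmod_morphism.
HB.instance Definition _ :=
  GRing.isMonoidMorphism.Build A L (@lconst A) lconst_is_monoid_morphism.

Lemma lge_is_zmod_morphism r : zmod_morphism (@lge A r).
Proof.
move=> S U; apply: laurent_eqP => j.
by rewrite [RHS]laurentBE /=; case: ifP => // _; rewrite subr0.
Qed.
HB.instance Definition _ r :=
  GRing.isZmodMorphism.Build L L (@lge A r) (lge_is_zmod_morphism r).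

Lemma bounded_lge0 r S : bounded_by S (r - 1) -> lge r S = 0.
Proof.
move=> Sr; apply: laurent_eqP => j; rewrite laurent0E /=.
by case: ifP => // rj; apply: Sr; lia.
Qed.

Lemma dpE S j : dp S j = S (j + 1) *~ (j + 1).
Proof. by []. Qed.

Lemma dp_is_zmod_morphism : zmod_morphism (@dp A).
Proof. by move=> S U; apply: laurent_eqP => j; rewrite laurentBE /= -mulrzBl. Qed.
HB.instance Definition _ :=
  GRing.isZmodMorphism.Build L L (@dp A) dp_is_zmod_morphism.

Lemma dp_bounded_by d S : bounded_by S d -> bounded_by (dp S) (d - 1).
Proof. by move=> Sd j dj /=; rewrite Sd ?mul0rz //; lia. Qed.

Lemma dpM S U : dp (S * U) = dp S * U + S * dp U.
Proof.
have [[d Sd] [e Ue]] := (laurentP S, laurentP U).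
have Sd' := dp_bounded_by Sd; have Ue' := dp_bounded_by Ue.
(* This degree bounds all three products, so that [lmul_coefE] turns the coefficient [m] steps below
   it into finite sums with the same index set. *)
apply: (@bounded_eqP _ _ _ (d + e - 1)).
- by apply: dp_bounded_by; exact: boundedM.
- apply: boundedD; first by apply: bounded_le (boundedM Sd' Ue); lia.
  by apply: bounded_le (boundedM Sd Ue'); lia.
move=> m.
transitivity ((dp S * U) (d - 1 + e - m%:Z) + (S * dp U) (d + (e - 1) - m%:Z));
  last by congr (_ + _); congr (_ _); lia.
transitivity ((S * U) (d + e - m%:Z) *~ (d + e - m%:Z)).
  by rewrite [LHS]/= (_ : d + e - 1 - m%:Z + 1 = d + e - m%:Z) //; lia.
rewrite [X in X *~ _](lmul_coefE m Sd Ue) [X in _ = X + _](lmul_coefE m Sd' Ue).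
rewrite [X in _ = _ + X](lmul_coefE m Sd Ue') -big_split /=.
rewrite mulrz_suml; apply: eq_bigr => i _.
rewrite mulrzAl mulrzAr.
rewrite (_ : d - 1 - i%:Z + 1 = d - i%:Z); last by lia.
rewrite (_ : e - 1 - (m - i)%N%:Z + 1 = e - (m - i)%N%:Z); last by lia.
(* The weight splits over the two factors: (d - i) + (e - (m - i)) = d + e - m. *)
rewrite -mulrzDr; congr (_ *~ _); have := ltn_ord i; lia.
Qed.

Lemma dp_lconst c : dp (lconst c) = 0.
Proof.
apply: laurent_eqP => j; rewrite laurent0E /=.
by case: eqP => [->|_]; rewrite ?mulr0z ?mul0rz.
Qed.

Lemma iter_dp_bounded d S l :
  bounded_by S d -> bounded_by (iter l (@dp A) S) (d - l%:Z).
Proof.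
move=> Sd; elim: l => [|l IH]; first by rewrite subr0.
by rewrite iterS; apply: bounded_le (dp_bounded_by IH); lia.
Qed.

(** Higher Leibniz rule, by induction on [l] with Pascal's rule for the binomials. *)
Lemma iter_dpM l S U : iter l (@dp A) (S * U) =
  \sum_(i < l.+1) (iter i (@dp A) S * iter (l - i) (@dp A) U) *+ 'C(l, i).
Proof.
elim: l => [|l IH]; first by rewrite big_ord1.
rewrite iterS IH raddf_sum.
transitivity (\sum_(i < l.+1)
   ((iter i.+1 (@dp A) S * iter (l - i) (@dp A) U) *+ 'C(l, i) +
    (iter i (@dp A) S * iter (l.+1 - i) (@dp A) U) *+ 'C(l, i))).
  apply: eq_bigr => i _; rewrite raddfMn /= dpM mulrnDl; congr (_ + _ * _ *+ _).
  by rewrite -iterS -subSn // -ltnS.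
rewrite big_split /= [RHS]big_ord_recl /= bin0 addrC.
under [in RHS]eq_bigr => i _ do rewrite /bump /= add1n binS mulrnDr subSS.
rewrite [in RHS]big_split /= addrA; congr (_ + _).
rewrite big_ord_recl /= bin0 ?subn0; congr (_ + _).
rewrite [in RHS]big_ord_recr /= bin_small // mulr0n addr0.
by apply: eq_bigr => i _; rewrite /bump /= add1n subSS.
Qed.

(** Treating series without negative powers as polynomials turns [leval] into [horner] and the shift
    of p into polynomial composition. *)
Definition lpoly (q : {poly A}) : L.
refine (@Laurent _ (fun j => if j is Posz i then q`_i else 0) _).
by exists (size q)%:Z; case=> // i qi; rewrite nth_default // ltnW.
Defined.

Lemma lpolyC c : lpoly c%:P = lconst c.
Proof. by apply: laurent_eqP => -[i|i] //=; rewrite coefC. Qed.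

Lemma lpoly_is_zmod_morphism : zmod_morphism lpoly.
Proof.
move=> q r; apply: laurent_eqP => -[i|i]; rewrite laurentBE /= ?coefB //.
by rewrite subr0.
Qed.
HB.instance Definition _ :=
  GRing.isZmodMorphism.Build {poly A} L lpoly lpoly_is_zmod_morphism.

Lemma lpolyMX q : lpoly (q * 'X) = lpoly q * lmono 1 1.
Proof.
apply: laurent_eqP => j; rewrite [lpoly q * _]mulrC lmonoM mul1r.
case: j => [[|i]|i] //=; first by rewrite coefMX.
by rewrite coefMX /= subn1.
Qed.

Lemma lpolyX : lpoly 'X = lmono 1 1.
Proof. by rewrite -['X]mul1r lpolyMX lpolyC rmorph1 mul1r. Qed.

Lemma lpolyM q r : lpoly (q * r) = lpoly q * lpoly r.
Proof.
elim/poly_ind: r => [|r c IH]; first by rewrite mulr0 !raddf0 mulr0.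
rewrite mulrDr mulrA !raddfD /= !lpolyMX IH mulrDr mulrA; congr (_ + _).
rewrite [q * _]mulrC mul_polyC lpolyC mulrC; apply: laurent_eqP => j.
by rewrite lconst_mulE; case: j => i /=; rewrite ?coefZ ?mulr0.
Qed.

Lemma dp_lpoly q : dp (lpoly q) = lpoly q^`().
Proof.
apply: laurent_eqP => -[i|[|i]]; rewrite dpE.
- have -> : i%:Z + 1 = i.+1%:Z by lia.
  by rewrite [RHS]/= coef_deriv.
- by have -> : Negz 0 + 1 = 0 by [].
- have -> : Negz i.+1 + 1 = Negz i by lia.
  by rewrite [lpoly q _]/= mul0rz.
Qed.

Lemma leval_lpoly q b : leval (lpoly q) b = q.[b].
Proof.
rewrite /leval horner_coef (fsbig_ord _ _ (fun i => q`_i * b ^+ i)).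
rewrite -(@fsbig_widen _ _ _ _ `I_(size q)%classic setT) //.
by move=> i [_ /= /negP]; rewrite -leqNgt => qi; rewrite /= nth_default ?mul0r.
Qed.

Lemma lge_lpoly S : exists q, lge 0 S = lpoly q.
Proof.
have [d Sd] := laurentP S.
exists (\poly_(i < `|d|.+1) S i%:Z); apply: laurent_eqP => -[i|i] //=.
rewrite coef_poly; case: ltnP => // di; apply: Sd; lia.
Qed.

Lemma lge1_lpoly S : exists2 q, lge 1 S = lpoly q & q`_0 = 0.
Proof.
have [q qE] := lge_lpoly S; exists (q - (q`_0)%:P); last first.
  by rewrite coefB coefC eqxx subrr.
rewrite raddfB /= lpolyC -qE.
have -> : q`_0 = S 0 by have := congr1 (fun V => coef_of V 0) qE.
apply: laurent_eqP => j; rewrite laurentBE; case: j => [[|i]|i] /=.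
- by rewrite subrr.
- by rewrite subr0.
- by rewrite subr0.
Qed.

Lemma lge1_of_lpoly q : lge 1 (lpoly q) = lpoly q - lconst q`_0.
Proof.
apply: laurent_eqP => j; rewrite laurentBE; case: j => [[|i]|i] /=.
- by rewrite subrr.
- by rewrite subr0.
- by rewrite subr0.
Qed.

Lemma inv_p_minusP b : inv_p_minus b * (lmono 1 1 - lconst b) = 1.
Proof.
rewrite mulrC mulrBl; apply: laurent_eqP => j; rewrite laurentBE lmonoM lconst_mulE mul1r.
case: j => [[|i]|i].
- have -> : 0 - 1 = Negz 0 by [].
  by rewrite /= expr0 mulr0 subr0.
- have -> : i.+1%:Z - 1 = i%:Z by lia.
  by rewrite /= mulr0 subr0.
- have -> : Negz i - 1 = Negz i.+1 by lia.
  by rewrite /= exprS subrr.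
Qed.

(** Characterises the geometric expansion as an inverse in the ring, hence in a form that ring
    morphisms transport. *)
Lemma inv_p_minus_unique b S :
  S * (lmono 1 1 - lconst b) = 1 -> S = inv_p_minus b.
Proof.
move=> S1; rewrite -[S]mulr1 -(inv_p_minusP b) mulrCA S1.
by rewrite mulr1.
Qed.

Lemma monic_bounded n S : monic_of_degree n S -> bounded_by S n%:Z.
Proof. by case. Qed.

Lemma monicX S k : monic_of_degree 1 S -> monic_of_degree k (S ^+ k).
Proof.
move=> [S1 Sb]; elim: k => [|k [IH1 IHb]].
  by split=> //; exact: lconst_bounded0.
split.
  by rewrite exprSr -addn1 PoszD lead_coefM // IH1 S1 mulr1.
by rewrite exprSr -addn1 PoszD; exact: boundedM.
Qed.

(** [G] is the cofactor of [S - U] in [S ^+ n - U ^+ n]. Each of its [n] terms is monic of degree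
    [n.-1], so its top coefficient is [n%:R]. *)
Lemma geometric_sum_monic n S U : monic_of_degree 1 S -> monic_of_degree 1 U ->
  let G := \sum_(i < n) S ^+ (n.-1 - i) * U ^+ i in
  bounded_by G n.-1%:Z /\ G n.-1%:Z = n%:R.
Proof.
move=> S1 U1 G.
have dE (i : 'I_n) : n.-1%:Z = (n.-1 - i)%N%:Z + i%:Z by have := ltn_ord i; lia.
have Sb i := monic_bounded (monicX i S1).
have Ub i := monic_bounded (monicX i U1).
split.
  by apply: bounded_sum => i _; rewrite (dE i); exact: boundedM.
rewrite laurent_sumE (eq_bigr (fun=> 1)); last first.
  move=> i _; rewrite (dE i) lead_coefM //.
  by rewrite (monicX _ S1).1 (monicX _ U1).1 mulr1.
by rewrite sumr_const card_ord.
Qed.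

Lemma monic_sub_bounded n S U d : (0 < n)%N -> GRing.rreg (n%:R : A) ->
  monic_of_degree 1 S -> monic_of_degree 1 U ->
  bounded_by (S ^+ n - U ^+ n) (d + n.-1%:Z) -> bounded_by (S - U) d.
Proof.
move=> n0 nreg S1 U1; rewrite subrXX.
have [Gb Gn] := geometric_sum_monic n S1 U1.
by apply: bounded_cancel => //; rewrite Gn.
Qed.

Lemma monic_subX_bounded k S U d :
  monic_of_degree 1 S -> monic_of_degree 1 U ->
  bounded_by (S - U) d -> bounded_by (S ^+ k - U ^+ k) (d + k.-1%:Z).
Proof.
move=> S1 U1 SUd; rewrite subrXX.
by have [Gb _] := geometric_sum_monic k S1 U1; exact: boundedM.
Qed.

Lemma monic_add S U : monic_of_degree 1 S -> bounded_by U 0 ->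
  monic_of_degree 1 (S + U).
Proof.
move=> [S1 Sb] U0; split.
  by rewrite laurentDE S1 U0 // addr0.
by apply: boundedD => //; exact: bounded_le U0.
Qed.

End LaurentSeries.

(** * Existence, uniqueness and stability of roots of monic series *)

Section Roots.
Variable A : comUnitRingType.
Local Notation L := (laurent A).
Implicit Types (S U M : L).
Variable n : nat.
Hypothesis n_unit : (n.+1%:R : A) \is a GRing.unit.

Let nreg : GRing.rreg (n.+1%:R : A).
Proof. by move=> x y; exact: (mulIr n_unit). Qed.

Lemma monic_root_inj S U : monic_of_degree 1 S -> monic_of_degree 1 U ->
  S ^+ n.+1 = U ^+ n.+1 -> S = U.
Proof.
move=> S1 U1 SU; apply/eqP; rewrite -subr_eq0; apply/eqP.
apply: (@bounded_eq0 _ 0) => m; apply: (monic_sub_bounded _ nreg) => //.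
by rewrite SU subrr => j _; exact: laurent0E.
Qed.

(* Each step corrects the coefficient of degree [n - m] of [S ^+ n.+1]. *)
Fixpoint approx_root M (m : nat) : L :=
  if m is m'.+1 then
    let S := approx_root M m' in
    S + lmono ((M - S ^+ n.+1) (n%:Z - m'%:Z) / n.+1%:R) (- m'%:Z)
  else lmono 1 1.

(** Adding [lmono c (- m%:Z)] changes the power by this monomial times a cofactor with top
    coefficient [n.+1%:R]; [c] is chosen to cancel the top coefficient of the error. *)
Lemma approx_rootP M : monic_of_degree n.+1 M -> forall m,
  monic_of_degree 1 (approx_root M m) /\
  bounded_by (M - approx_root M m ^+ n.+1) (n%:Z - m%:Z).
Proof.
move=> [M1 Mb]; elim=> [|m [S1 Sb]].
  have X1 : monic_of_degree 1 (lmono 1 1 : L).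
    by split=> //; exact: lmono_bounded.
  have nE : n%:Z + 1 = n.+1%:Z by lia.
  split=> //; rewrite subr0; apply: boundedP; rewrite nE.
    by apply: boundedB => //; exact: monic_bounded (monicX _ X1).
  by rewrite laurentBE M1 (monicX _ X1).1 subrr.
set S := approx_root M m in S1 Sb *.
pose c := (M - S ^+ n.+1) (n%:Z - m%:Z) / n.+1%:R.
rewrite [approx_root M m.+1](_ : _ = S + lmono c (- m%:Z)) //.
set T := S + lmono c (- m%:Z).
have T1 : monic_of_degree 1 T.
  apply: (monic_add S1); apply: (bounded_le _ (@lmono_bounded _ c (- m%:Z))).
  by lia.
split=> //.
have -> : M - T ^+ n.+1 = (M - S ^+ n.+1) - (T ^+ n.+1 - S ^+ n.+1).
  by rewrite opprB addrA subrK.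
rewrite subrXX [T - S]addrAC subrr add0r.
have [Gb Gn] := geometric_sum_monic n.+1 T1 S1.
set G := \sum_(i < _) _ in Gb Gn *.
have dE : n%:Z - m%:Z = - m%:Z + n.+1.-1%:Z by lia.
have sE : n%:Z - m.+1%:Z + 1 = n%:Z - m%:Z by lia.
apply: boundedP; rewrite sE.
  apply: boundedB => //; rewrite dE; apply: boundedM => //.
  exact: lmono_bounded.
by rewrite laurentBE lmonoM opprK subrK Gn /c divrK // subrr.
Qed.

(** Passing from stage [m] to stage [m.+1] alters only the coefficient of degree [- m], so higher
    coefficients are already final. *)
Lemma approx_root_stable M (i m : nat) j :
  - i%:Z < j -> (i <= m)%N -> approx_root M m j = approx_root M i j.
Proof.
move=> ij; elim: m => [|m IH]; first by rewrite leqn0 => /eqP ->.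
rewrite leq_eqVlt => /orP[/eqP ->//|im]; rewrite -IH //.
by rewrite [LHS]laurentDE /= ifF ?addr0 //; lia.
Qed.

Lemma monic_root_exists M : monic_of_degree n.+1 M ->
  exists S, monic_of_degree 1 S /\ S ^+ n.+1 = M.
Proof.
move=> M1; have R := approx_rootP M1.
(* The root is the diagonal limit: since - (|j| + 1) < j, the coefficient of degree [j] no longer
   changes after stage [|j| + 1]. *)
have Sb : exists d, bounded_by (fun j => approx_root M `|j|.+1 j) d.
  by exists 1 => j j1; have [/monic_bounded ->] := R `|j|.+1.
pose S := Laurent Sb.
have SE m : bounded_by (S - approx_root M m) (- m%:Z).
  move=> j mj; rewrite laurentBE -[S j]/(approx_root M `|j|.+1 j).
  rewrite -(@approx_root_stable M _ (maxn `|j|.+1 m) j _ (leq_maxl _ _)).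
    by rewrite (approx_root_stable M mj (leq_maxr _ _)) subrr.
  by lia.
have S1 : monic_of_degree 1 S.
  have := monic_add (R 0%N).1 (SE 0%N).
  by rewrite addrC subrK.
exists S; split=> //; apply/eqP; rewrite eq_sym -subr_eq0; apply/eqP.
apply: (@bounded_eq0 _ n) => m; have [m1 mb] := R m.
have -> : M - S ^+ n.+1 = (M - approx_root M m ^+ n.+1)
    - (S ^+ n.+1 - approx_root M m ^+ n.+1) by rewrite opprB addrA subrK.
apply: (boundedB mb).
apply: (bounded_le _ (monic_subX_bounded S1 m1 (SE m))).
by lia.
Qed.

Lemma lrootP M : monic_of_degree n.+1 M ->
  monic_of_degree 1 (lroot n.+1 M) /\ lroot n.+1 M ^+ n.+1 = M.
Proof. by move=> /monic_root_exists; exact: (@xgetPex _ 0). Qed.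

Lemma lrootK S : monic_of_degree 1 S -> lroot n.+1 (S ^+ n.+1) = S.
Proof.
move=> S1; have [r1 rE] := lrootP (monicX n.+1 S1).
exact: monic_root_inj.
Qed.

(* Changing [M] in degrees <= 0 changes its root only in degrees <= - n, hence
   the k-th power of the root only in degrees <= k - 1 - n. *)
Lemma lroot_perturb k M S : (0 < k <= n)%N -> monic_of_degree 1 S ->
  monic_of_degree n.+1 M -> bounded_by (M - S ^+ n.+1) 0 ->
  lge 0 (lroot n.+1 M ^+ k) = lge 0 (S ^+ k).
Proof.
move=> /andP[k0 kn] S1 M1 MS; have [r1 rE] := lrootP M1.
apply/eqP; rewrite -subr_eq0 -raddfB; apply/eqP/bounded_lge0.
(* The power [n.+1] raises the degree of the difference of roots by [n], which gives the bound
   [- n]; the [k]-th powers then differ in degrees at most k - 1 - n, which is negative. *)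
have := @monic_subX_bounded _ k _ _ (- n%:Z) r1 S1.
move=> /(_ _)/bounded_le; apply; first by lia.
apply: (monic_sub_bounded _ nreg) => //.
by rewrite rE addNr.
Qed.

End Roots.

(** * The shift p -> p + phi_X *)

Section Taylor.
Variable A : comUnitRingType.
Hypothesis natr_unit : forall n, (n.+1%:R : A) \is a GRing.unit.
Local Notation L := (laurent A).
Implicit Types (S U V : L) (u c : A) (d e : int) (K l : nat).

Definition taylor_coef u l : A := u ^+ l / l`!%:R.

Definition taylor_term u l S : L := lconst (taylor_coef u l) * iter l (@dp A) S.

(** Truncation of the series defining [exp_neg_ad]: a finite sum in the ring of series, exact in all
    degrees above d - K when [S] has degree at most d. *)
Definition taylor u K S : L := \sum_(l < K) taylor_term u l S.

Lemma fact_unit l : (l`!%:R : A) \is a GRing.unit.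
Proof. by rewrite -(prednK (fact_gt0 l)). Qed.

Lemma taylor_coef0 u : taylor_coef u 0 = 1.
Proof. by rewrite /taylor_coef expr0 fact0 divr1. Qed.

(** The binomial identity behind the multiplicativity of an exponential; factorials are cancelled as
    units. *)
Lemma taylor_coefM u l i : (i <= l)%N ->
  taylor_coef u l *+ 'C(l, i) = taylor_coef u i * taylor_coef u (l - i).
Proof.
move=> il; rewrite /taylor_coef mulrACA -exprD subnKC // -mulrnAr.
congr (_ * _); apply: (mulrI (fact_unit l)).
rewrite mulrnAr divrr ?fact_unit //.
rewrite -(bin_fact il) !natrM -!mulrA.
rewrite [(l - i)`!%:R * _]mulrCA divrr ?fact_unit // mulr1.
by rewrite divrr ?fact_unit // mulr1.
Qed.

Lemma taylor_term_bounded u d l S :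
  bounded_by S d -> bounded_by (taylor_term u l S) (d - l%:Z).
Proof.
move=> Sd; rewrite -[d - _]add0r; apply: boundedM.
  exact: lconst_bounded0.
exact: iter_dp_bounded.
Qed.

Lemma taylor_bounded u d K S : bounded_by S d -> bounded_by (taylor u K S) d.
Proof.
move=> Sd; apply: bounded_sum => l _.
by apply: (bounded_le _ (@taylor_term_bounded u _ l _ Sd)); lia.
Qed.

Lemma taylor_termM u l S U : taylor_term u l (S * U) =
  \sum_(i < l.+1) taylor_term u i S * taylor_term u (l - i) U.
Proof.
rewrite /taylor_term iter_dpM mulr_sumr; apply: eq_bigr => i _.
by rewrite mulrACA -rmorphM -taylor_coefM -1?ltnS // mulrnAr -mulrnAl -rmorphMn.
Qed.

(* As polynomials in an auxiliary variable evaluated at 1, the Taylor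
   polynomial of the product is the truncation of the product of the Taylor
   polynomials. *)
Lemma taylorM_bounded u d e K S U : bounded_by S d -> bounded_by U e ->
  bounded_by (taylor u K (S * U) - taylor u K S * taylor u K U) (d + e - K%:Z).
Proof.
move=> Sd Ue; pose G V := \poly_(l < K) taylor_term u l V.
have GE V : taylor u K V = (G V).[1].
  by rewrite horner_poly; apply: eq_bigr => l _; rewrite expr1n mulr1.
(* The surplus terms have total order at least [K], and each derivative lowers the degree by one. *)
have prodE : taylor u K S * taylor u K U = taylor u K (S * U) +
    \sum_(l < K) (G S * G U)`_(K + l).
  rewrite !GE -hornerM (@horner_coef_wide _ (K + K)); last first.
    apply: leq_trans (size_polyMleq _ _) _; apply: leq_trans (leq_pred _) _.
    by rewrite leq_add ?size_poly.
  rewrite big_split_ord /= -GE; congr (_ + _); last first.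
    by apply: eq_bigr => l _; rewrite expr1n mulr1.
  apply: eq_bigr => l _; rewrite expr1n mulr1 taylor_termM coefM.
  apply: eq_bigr => i _; have := ltn_ord l; have := ltn_ord i => il lK.
  by rewrite !coef_poly !ifT //; lia.
rewrite prodE opprD addrA subrr add0r; apply: boundedN.
apply: bounded_sum => l _; rewrite coefM.
apply: bounded_sum => i _; rewrite !coef_poly.
have zero_bounded (c : int) : bounded_by (0 : L) c by move=> j _; exact: laurent0E.
case: ifP => _; last by rewrite mul0r; exact: zero_bounded.
case: ifP => _; last by rewrite mulr0; exact: zero_bounded.
apply: (bounded_le _ (boundedM (@taylor_term_bounded u _ i _ Sd)
  (@taylor_term_bounded u _ (K + l - i) _ Ue))).
by have := ltn_ord i; lia.
Qed.

Lemma iter_dp_lconst c l : iter l.+1 (@dp A) (lconst c) = 0.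
Proof. by rewrite iterSr dp_lconst; elim: l => //= l ->; rewrite raddf0. Qed.

Lemma taylor_lconst u K c : taylor u K.+1 (lconst c) = lconst c.
Proof.
rewrite /taylor big_ord_recl big1 ?addr0 => [|l _].
  by rewrite /taylor_term taylor_coef0 rmorph1 mul1r.
by rewrite /taylor_term [iter _ _ _]iter_dp_lconst mulr0.
Qed.

Lemma taylor_X u K : taylor u K.+2 (lmono 1 1) = lmono 1 1 + lconst u.
Proof.
have dX : dp (lmono (1 : A) 1) = lconst 1.
  by rewrite -lpolyX dp_lpoly derivX -lpolyC.
rewrite /taylor !big_ord_recl big1 ?addr0 => [|l _].
  rewrite /taylor_term taylor_coef0 rmorph1 mul1r /= dX; congr (_ + _).
  by rewrite /taylor_coef expr1 divr1 rmorph1 mulr1.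
by rewrite /taylor_term [iter _ _ _]iterSr dX iter_dp_lconst mulr0.
Qed.

Lemma iter_dpB l S U : iter l (@dp A) (S - U) = iter l (@dp A) S - iter l (@dp A) U.
Proof. by elim: l => // l IH; rewrite !iterS IH raddfB. Qed.

Lemma taylorB u K S U : taylor u K (S - U) = taylor u K S - taylor u K U.
Proof.
rewrite /taylor -sumrB; apply: eq_bigr => l _.
by rewrite /taylor_term iter_dpB mulrBr.
Qed.

Lemma dp_lconstM c S : dp (lconst c * S) = lconst c * dp S.
Proof. by rewrite dpM dp_lconst mul0r add0r. Qed.

Lemma dp_taylor u K S : dp (taylor u K S) = taylor u K (dp S).
Proof.
rewrite /taylor raddf_sum; apply: eq_bigr => l _ /=.
by rewrite /taylor_term dp_lconstM -iterS iterSr.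
Qed.

End Taylor.

(** * Time derivatives of functions and of series *)

Section TimeDerivatives.
Variables (R : realType) (D : domain R).
Local Notation A := (smooth_fun D).
Implicit Types (f g : A) (S U : laurent A) (j : nat).

(** Sums and products in [smooth_fun] follow the pointwise formulas on the domain; as the domain is
    open, the derivative can be computed from such a formula [h]. *)
Lemma dT_eq j f (h : time_space R -> R) (dh : R) T : D T ->
  (forall T', D T' -> f T' = h T') -> is_derive (T j.-1) 1 (slice h j.-1 T) dh ->
  dT j f T = dh.
Proof.
move=> DT fh [_ hE]; rewrite [LHS]mk_smoothE //.
rewrite (eq_partial _ (dom_open D) DT (g := h)); first by rewrite /partial derive1E.
by move=> T'; rewrite inE => /fh.
Qed.

Lemma dT_is_derive j f T : D T -> is_derive (T j.-1) 1 (slice f j.-1 T) (dT j f T).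
Proof.
by move=> DT; rewrite mk_smoothE //; exact: smooth_is_derive (smooth_funP f) DT.
Qed.

Lemma dT_is_zmod_morphism j : zmod_morphism (@dT R D j).
Proof.
move=> f g; apply: smooth_eqP => T DT.
have addE (x y : A) T' : D T' -> (x + y) T' = x T' + y T' by exact: mk_smoothE.
have oppE (x : A) T' : D T' -> (- x) T' = - x T' by exact: mk_smoothE.
transitivity (dT j f T - dT j g T); last by rewrite addE // oppE.
apply: (dT_eq (h := fun T' => f T' - g T') DT).
  by move=> T' DT'; rewrite addE // oppE.
exact: is_deriveB (dT_is_derive j f DT) (dT_is_derive j g DT).
Qed.
HB.instance Definition _ j :=
  GRing.isZmodMorphism.Build A A (@dT R D j) (dT_is_zmod_morphism j).

Lemma dTM j f g : dT j (f * g) = dT j f * g + f * dT j g.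
Proof.
apply: smooth_eqP => T DT.
have addE (x y : A) T' : D T' -> (x + y) T' = x T' + y T' by exact: mk_smoothE.
have mulE (x y : A) T' : D T' -> (x * y) T' = x T' * y T' by exact: mk_smoothE.
transitivity (dT j f T * g T + f T * dT j g T); last by rewrite addE // !mulE.
apply: (dT_eq (h := fun T' => f T' * g T') DT).
  by move=> T' DT'; rewrite mulE.
apply: is_derive_eq.
  exact: is_deriveM (dT_is_derive j f DT) (dT_is_derive j g DT).
by rewrite /slice !dfwith_self /GRing.scale /= addrC [g T * _]mulrC.
Qed.

Lemma dT1 j : dT j (1 : A) = 0.
Proof.
by apply: (addrI (dT j (1 : A))); rewrite addr0 -[in RHS](mulr1 1) dTM mulr1 mul1r.
Qed.

Lemma dT_natr j m : dT j (m%:R : A) = 0.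
Proof. by rewrite raddfMn /= dT1 mul0rn. Qed.

(** Chain rule for f^(l+1) / (l+1)!, by induction from the recursion (l+1) c_(l+1) = f c_l and
    cancellation of the unit l+1. *)
Lemma dT_taylor_coef j f l :
  dT j (taylor_coef f l.+1) = dT j f * taylor_coef f l.
Proof.
have coefS m : taylor_coef f m.+1 * m.+1%:R = f * taylor_coef f m.
  rewrite /taylor_coef exprS factS natrM invrM ?fact_unit ?smooth_natr_unit //;
    last by move=> ?; exact: smooth_natr_unit.
  by rewrite -!mulrA mulVr ?smooth_natr_unit // mulr1.
have natM (x : A) m : dT j x * m%:R = dT j (x * m%:R).
  by rewrite dTM dT_natr mulr0 addr0.
apply: (mulIr (smooth_natr_unit D l)); elim: l => [|l IH].
  by rewrite natM coefS taylor_coef0 !mulr1.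
rewrite natM coefS dTM.
have -> : dT j (taylor_coef f l.+1) = dT j f * taylor_coef f l.
  exact: (mulIr (smooth_natr_unit D l)).
rewrite [f * (_ * _)]mulrCA -coefS -[l.+2]addn1 natrD mulrDr mulr1 addrC.
by rewrite mulrA.
Qed.

Lemma ldT_is_zmod_morphism j : zmod_morphism (@ldT R D j).
Proof.
by move=> S U; apply: laurent_eqP => i; rewrite laurentBE /= -raddfB.
Qed.
HB.instance Definition _ j :=
  GRing.isZmodMorphism.Build _ _ (@ldT R D j) (ldT_is_zmod_morphism j).

Lemma ldT_lconst j f : ldT j (lconst f) = lconst (dT j f).
Proof. by apply: laurent_eqP => i /=; case: eqP => // _; exact: dT0. Qed.

Lemma ldT_lconstM j f S :
  ldT j (lconst f * S) = lconst (dT j f) * S + lconst f * ldT j S.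
Proof.
apply: laurent_eqP => i; rewrite laurentDE !lconst_mulE.
by rewrite [LHS]/= -[lmul_coef _ _ _]/((lconst f * S) i) lconst_mulE dTM.
Qed.

Lemma ldT_bounded_by j S d : bounded_by S d -> bounded_by (ldT j S) d.
Proof. by move=> Sd i di /=; rewrite Sd // dT0. Qed.

Lemma ldT_dp j S : ldT j (dp S) = dp (ldT j S).
Proof. by apply: laurent_eqP => i /=; rewrite raddfMz. Qed.

Lemma ldT_iter_dp j l S : ldT j (iter l (@dp A) S) = iter l (@dp A) (ldT j S).
Proof. by elim: l => // l IH; rewrite !iterS ldT_dp IH. Qed.

(** Differentiating a coefficient lowers its index by one and kills the constant one of index 0, so
    the second sum stops at [K] instead of [K.+1]. *)
Lemma ldT_taylor j f K S : ldT j (taylor f K.+1 S) =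
  taylor f K.+1 (ldT j S) + lconst (dT j f) * dp (taylor f K S).
Proof.
rewrite raddf_sum /= (eq_bigr (fun l : 'I_K.+1 =>
  taylor_term f l (ldT j S) +
  lconst (dT j (taylor_coef f l)) * iter l (@dp A) S)); last first.
  by move=> l _; rewrite ldT_lconstM addrC ldT_iter_dp.
rewrite big_split /=; congr (_ + _).
rewrite big_ord_recl taylor_coef0 dT1 rmorph0 mul0r add0r.
rewrite raddf_sum mulr_sumr; apply: eq_bigr => l _ /=.
by rewrite dT_taylor_coef rmorphM /taylor_term dp_lconstM mulrA.
Qed.

End TimeDerivatives.

(** * The operator [exp_neg_ad] as a ring morphism *)

Section ExpNegAd.
Variables (R : realType) (D : domain R) (phi : smooth_fun D).
Local Notation A := (smooth_fun D).
Local Notation E := (exp_neg_ad phi).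
Local Notation u := (dT 1 phi).
Implicit Types (S U : laurent A) (f b : A) (d m : int) (K : nat).

Let natr_unit : forall n, (n.+1%:R : A) \is a GRing.unit := @smooth_natr_unit R D.

(** Since [phi] does not depend on p, its bracket with S is - phi_X S_p; the factors phi_X are
    constants for d/dp and collect into a power. *)
Lemma iter_poisson_lconst l S : iter l (poisson (lconst phi)) S =
  lconst ((- u) ^+ l) * iter l (@dp A) S.
Proof.
elim: l => [|l IH]; first by rewrite rmorph1 mul1r.
rewrite !iterS IH /poisson dp_lconst mul0r sub0r ldT_lconst dp_lconstM.
by rewrite mulrA -rmorphM -mulNr -rmorphN /= -mulNr -exprS.
Qed.

Lemma exp_neg_adE S d K m : bounded_by S d -> d - K%:Z < m ->
  E S m = taylor u K S m.
Proof.
move=> Sd Km; rewrite /taylor laurent_sumE [LHS]/=.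
rewrite (eq_fsbigr (fun l => taylor_term u l S m)); last first.
  move=> l _; rewrite iter_poisson_lconst !lconst_mulE.
  (* The sign of [exp (- ad phi)] cancels the sign coming from the bracket. *)
  have -> : taylor_coef u l = (-1) ^+ l / l`!%:R * (- u) ^+ l.
    rewrite [(- u) ^+ l]exprNn mulrACA -exprD addnn -signr_odd odd_double expr0.
    by rewrite mul1r mulrC.
  by rewrite mulrA.
rewrite (fsbig_ord _ _ (fun l => taylor_term u l S m)).
rewrite -(@fsbig_widen _ _ _ _ `I_K%classic setT) //.
move=> l [_ /= /negP]; rewrite -leqNgt => Kl.
by apply: (@taylor_term_bounded _ u _ l _ Sd); lia.
Qed.

Lemma exp_neg_ad_taylor S d K : bounded_by S d ->
  bounded_by (E S - taylor u K S) (d - K%:Z).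
Proof. by move=> Sd m Km; rewrite laurentBE (exp_neg_adE Sd Km) subrr. Qed.

Lemma exp_neg_ad_lead S d : bounded_by S d -> E S d = S d.
Proof.
move=> Sd; rewrite (exp_neg_adE (K := 1) Sd); last by lia.
by rewrite /taylor big_ord1 /taylor_term taylor_coef0 rmorph1 mul1r.
Qed.

Lemma exp_neg_ad_bounded_by S d : bounded_by S d -> bounded_by (E S) d.
Proof.
move=> Sd m dm; rewrite (exp_neg_adE (K := 0) Sd); last by lia.
by rewrite /taylor big_ord0 laurent0E.
Qed.

Lemma exp_neg_ad_is_zmod_morphism : zmod_morphism E.
Proof.
move=> S U; have [[d Sd] [e Ue]] := (laurentP S, laurentP U).
have {}Sd : bounded_by S (Num.max d e) by apply: bounded_le Sd; lia.
have {}Ue : bounded_by U (Num.max d e) by apply: bounded_le Ue; lia.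
move: (Num.max d e) Sd Ue => c Sc Uc; apply: laurent_eqP => m.
have Km : c - (`|c - m|.+1)%N%:Z < m by lia.
rewrite laurentBE (exp_neg_adE Sc Km) (exp_neg_adE Uc Km).
by rewrite (exp_neg_adE (boundedB Sc Uc) Km) taylorB.
Qed.
HB.instance Definition _ :=
  GRing.isZmodMorphism.Build _ _ E exp_neg_ad_is_zmod_morphism.

Lemma exp_neg_ad_lconst f : E (lconst f) = lconst f.
Proof.
apply: laurent_eqP => m.
rewrite (exp_neg_adE (K := `|m|.+1) (@lconst_bounded0 _ f)); last by lia.
by rewrite taylor_lconst.
Qed.

Lemma exp_neg_adM S U : E (S * U) = E S * E U.
Proof.
have [[d Sd] [e Ue]] := (laurentP S, laurentP U).
apply/eqP; rewrite -subr_eq0; apply/eqP.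
apply: (@bounded_eq0 _ (d + e)) => K.
set tS := taylor u K S; set tU := taylor u K U.
(* Every bracketed difference is a truncation error, so the whole has degree at most d + e - K. *)
have -> : E (S * U) - E S * E U = (E (S * U) - taylor u K (S * U))
    + (taylor u K (S * U) - tS * tU)
    - ((E S - tS) * E U + tS * (E U - tU)) by ring.
apply: boundedB.
  apply: boundedD; first by apply: exp_neg_ad_taylor; exact: boundedM.
  exact: taylorM_bounded.
apply: boundedD.
  apply: (bounded_le _ (boundedM (exp_neg_ad_taylor (K := K) Sd)
    (exp_neg_ad_bounded_by Ue))).
  by lia.
apply: (bounded_le _ (boundedM (@taylor_bounded _ u _ K _ Sd)
    (exp_neg_ad_taylor (K := K) Ue))).
by lia.
Qed.

Lemma exp_neg_ad_is_monoid_morphism : monoid_morphism E.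
Proof. by split; [exact: exp_neg_ad_lconst|exact: exp_neg_adM]. Qed.
HB.instance Definition _ :=
  GRing.isMonoidMorphism.Build _ _ E exp_neg_ad_is_monoid_morphism.

Lemma exp_neg_ad_X : E (lmono 1 1) = lmono 1 1 + lconst u.
Proof.
apply: laurent_eqP => m.
rewrite (exp_neg_adE (K := `|m|.+2) (@lmono_bounded _ 1 1)); last by lia.
by rewrite taylor_X.
Qed.

Lemma exp_neg_ad_lpoly q : E (lpoly q) = lpoly (q \Po ('X + u%:P)).
Proof.
elim/poly_ind: q => [|q c IH]; first by rewrite comp_poly0 !raddf0.
rewrite comp_poly_MXaddC !raddfD /= !lpolyM lpolyX !lpolyC exp_neg_adM IH.
by rewrite exp_neg_ad_X exp_neg_ad_lconst raddfD /= lpolyX lpolyC.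
Qed.

(** A morphism sends an inverse to an inverse, and it sends p - b to p + phi_X - b. *)
Lemma exp_neg_ad_inv_p_minus b : E (inv_p_minus b) = inv_p_minus (b - u).
Proof.
apply: inv_p_minus_unique.
have := congr1 E (inv_p_minusP b).
rewrite exp_neg_adM raddfB /= exp_neg_ad_X exp_neg_ad_lconst rmorph1 => <-.
by rewrite rmorphB; congr (_ * _); ring.
Qed.

Lemma dp_exp_neg_ad S : dp (E S) = E (dp S).
Proof.
have [d Sd] := laurentP S; have Sd' := dp_bounded_by Sd.
apply: laurent_eqP => m; have Km : d - (`|d - m|.+1)%N%:Z < m by lia.
rewrite (exp_neg_adE (K := `|d - m|.+1) Sd'); last by lia.
rewrite -dp_taylor !dpE (exp_neg_adE (K := `|d - m|.+1) Sd) //.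
by lia.
Qed.

(** Chain rule for the substitution: the last term comes from the dependence of the shift phi_X on
    T_j. It is checked coefficientwise on truncations, of orders [K.+1] and [K] as in
    [ldT_taylor]. *)
Lemma ldT_exp_neg_ad j S :
  ldT j (E S) = E (ldT j S) + lconst (dT j u) * E (dp S).
Proof.
have [d Sd] := laurentP S; apply: laurent_eqP => m.
pose K := `|d - m|.+1; rewrite laurentDE lconst_mulE -dp_exp_neg_ad dpE.
rewrite -[LHS]/(dT j (E S m)).
rewrite (exp_neg_adE (K := K.+1) Sd); last by lia.
rewrite (exp_neg_adE (K := K.+1) (@ldT_bounded_by _ _ j _ _ Sd)); last by lia.
rewrite (exp_neg_adE (K := K) Sd); last by lia.
by rewrite -dpE -lconst_mulE -laurentDE -ldT_taylor.
Qed.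

End ExpNegAd.

(** * The gauge transformation *)

Section GaugeTransformation.
Variables (R : realType) (D : domain R) (phi : smooth_fun D).
Local Notation A := (smooth_fun D).
Local Notation E := (exp_neg_ad phi).
Local Notation u := (dT 1 phi).
Implicit Types (S M L : laurent A) (f b : A).

(** The part of [S] of degree at most 0 keeps this bound under [E]; the rest becomes the polynomial
    q(p + phi_X), whose constant term is q(phi_X). *)
Lemma lge1_exp_neg_ad S :
  lge 1 (E S) = E (lge 1 S) - lconst (leval (lge 1 S) u).
Proof.
have Sb : bounded_by (S - lge 1 S) 0.
  by move=> j j0; rewrite laurentBE /= ifT ?subrr //; lia.
rewrite -[in LHS](subrK (lge 1 S) S) raddfD raddfD /= bounded_lge0 ?add0r; last first.
  by rewrite subrr; exact: exp_neg_ad_bounded_by.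
have [q -> _] := lge1_lpoly S.
rewrite exp_neg_ad_lpoly lge1_of_lpoly leval_lpoly -horner_coef0.
by rewrite horner_comp hornerD hornerX hornerC add0r.
Qed.

Lemma exp_neg_ad_monic L : monic_of_degree 1 L -> monic_of_degree 1 (E L).
Proof.
move=> [L1 Lb]; split; last exact: exp_neg_ad_bounded_by.
by rewrite (exp_neg_ad_lead phi Lb).
Qed.

(** The shift moves the poles to p_i - phi_X. The new constants a_i / (p_i - phi_X) are the
    opposites of a_i / (phi_X - p_i), so the function of T subtracted is the one prescribed for
    phi_(T_n). *)
Lemma transformed_Ln N (a p : 'I_N -> A) M :
  M = lge 1 M - source_terms a p ->
  lge 1 (E M) - source_terms a (fun i => p i - u) =
  E M - lconst (leval (lge 1 M) u - \sum_i (a i / p i + a i / (u - p i))).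
Proof.
move=> ME; rewrite lge1_exp_neg_ad [in E M]ME raddfB /=.
have -> : E (source_terms a p) =
    \sum_i lconst (a i / p i) + \sum_i lconst (a i) * inv_p_minus (p i - u).
  rewrite raddf_sum -big_split; apply: eq_bigr => i _ /=.
  by rewrite raddfD /= exp_neg_adM !exp_neg_ad_lconst exp_neg_ad_inv_p_minus.
have -> : \sum_i (a i / p i + a i / (u - p i)) =
    \sum_i (a i / p i) - \sum_i (a i / (p i - u)).
  rewrite -sumrB; apply: eq_bigr => i _.
  by rewrite -mulrN -invrN opprB.
rewrite /source_terms big_split /= !rmorphB !rmorph_sum /=.
by ring.
Qed.

Lemma lge10 S : lge 1 S = lge 1 (lge 0 S).
Proof. by apply: laurent_eqP => j /=; case: ifP => // j1; rewrite ifT //; lia. Qed.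

(** [E L] is the root of [E (L ^+ n.+1)], and subtracting [f] perturbs the power only in degree 0,
    so [lroot_perturb] applies. *)
Lemma Qpart_exp_neg_ad k n L f : (0 < k <= n)%N -> monic_of_degree 1 L ->
  Qpart k n.+1 (E (L ^+ n.+1) - lconst f) =
  E (Qpart k n.+1 (L ^+ n.+1)) - lconst (leval (Qpart k n.+1 (L ^+ n.+1)) u).
Proof.
move=> kn L1; have nU := smooth_natr_unit D n.
have EL1 := exp_neg_ad_monic L1.
rewrite /Qpart (lrootK nU L1) -lge1_exp_neg_ad.
have EX m : E (L ^+ m) = E L ^+ m by rewrite rmorphXn.
rewrite !EX.
rewrite lge10 (lroot_perturb nU kn EL1) -?lge10 //.
- have [M1 Mb] := monicX n.+1 EL1; split.
    by rewrite laurentBE M1 /= subr0.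
  move=> j nj; rewrite laurentBE Mb //= gt_eqF ?subr0 //; lia.
- rewrite addrAC subrr add0r; apply: boundedN; exact: lconst_bounded0.
Qed.

(** The terms in phi_(XX) cancel by antisymmetry. Those in phi_(X T_j) and phi_(X T_k) cancel
    against the brackets with [fj] and [fk], and the remaining functions against each other. *)
Lemma zero_curvature_exp_neg_ad j k S M (fj fk : A) :
  dT j phi = fj -> dT k phi = fk ->
  ldT j S - ldT k M + poisson S M = 0 ->
  ldT j (E S - lconst fk) - ldT k (E M - lconst fj)
    + poisson (E S - lconst fk) (E M - lconst fj) = 0.
Proof.
move=> fjE fkE /(congr1 E); rewrite /poisson !raddfB /= !dp_lconst !subr0.
rewrite !ldT_lconst !ldT_exp_neg_ad !dp_exp_neg_ad.
rewrite (dTC j) (dTC k) fjE fkE raddfD !raddfB /= !exp_neg_adM raddf0.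
have -> : dT j fk = dT k fj by rewrite -fkE dTC fjE.
(* With images under [E] and functions of T abstracted, the goal is a ring consequence of the image
   of the old equation. *)
move: (E _) (E _) (E _) (E _) (E _) (E _) (lconst _) (lconst _) (lconst _) (lconst _).
by move=> x1 x2 x3 x4 x5 x6 c1 c2 c3 c4 H; rewrite -[RHS]H; ring.
Qed.

End GaugeTransformation.

Theorem theorem4p2 (R : realType) (D : domain R) (k n N : nat)
    (k_ge1 : (1 <= k)%N) (k_ltn : (k < n)%N)
    (L : laurent (smooth_fun D)) (a p : 'I_N -> smooth_fun D)
    (P phi : smooth_fun D)
    (p_neq0 : forall i, nowhere0 (p i))
    (phiX_neqp : forall i, nowhere0 (dT 1 phi - p i))
    (P_neqp : forall i, nowhere0 (P - p i))
    (L_sato : monic_of_degree 1 L)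
    (Ln_eq : L ^+ n = lge 1 (L ^+ n) - source_terms a p)
    (L_dmKPSCS : dmKPSCS k n (L ^+ n) a p)
    (P_Tk : dT k P = dT 1 (leval (Qpart k n (L ^+ n)) P))
    (P_Tn : dT n P = dT 1 (leval (lge 1 (L ^+ n)) P
                           - \sum_i (a i / p i + a i / (P - p i))))
    (phi_Tk : dT k phi = leval (Qpart k n (L ^+ n)) (dT 1 phi))
    (phi_Tn : dT n phi = leval (lge 1 (L ^+ n)) (dT 1 phi)
                         - \sum_i (a i / p i + a i / (dT 1 phi - p i))) :
  let ta := a in
  let tp := fun i => p i - dT 1 phi in
  let tLn := lge 1 (exp_neg_ad phi (L ^+ n)) - source_terms ta tp in
  dmKPSCS k n tLn ta tp.
Proof.
move=> ta tp tLn.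
have tLnE : tLn = exp_neg_ad phi (L ^+ n) - lconst (dT n phi).
  by rewrite phi_Tn; exact: transformed_Ln.
move: tLn tLnE => tLn tLnE; rewrite {}/ta {P_Tk P_Tn phi_Tn Ln_eq}.
have [m mE] : exists m, n = m.+1 by exists n.-1; rewrite (ltn_predK k_ltn).
subst n; case: L_dmKPSCS => zero_curv sources.
have kn : (0 < k <= m)%N by rewrite k_ge1.
have tQE : Qpart k m.+1 tLn =
    exp_neg_ad phi (Qpart k m.+1 (L ^+ m.+1)) - lconst (dT k phi).
  by rewrite tLnE phi_Tk; exact: Qpart_exp_neg_ad.
rewrite /dmKPSCS tQE; split; first by rewrite tLnE; exact: zero_curvature_exp_neg_ad.
move: {zero_curv} sources tQE phi_Tk => + _ _; rewrite /Qpart.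
(* With [Q_k] a polynomial, evaluating q(p + phi_X) at p_i - phi_X gives back q(p_i). *)
have [q -> _] := lge1_lpoly (lroot m.+1 (L ^+ m.+1) ^+ k).
move=> sources i; have [a_Tk p_Tk] := sources i; split.
  rewrite a_Tk raddfB /= dp_lconst subr0 dp_exp_neg_ad dp_lpoly.
  rewrite exp_neg_ad_lpoly !leval_lpoly.
  by rewrite horner_comp hornerD hornerX hornerC subrK.
(* As phi_(X T_k) is the X-derivative of phi_(T_k), both sides are X-derivatives and their arguments
   are compared. *)
rewrite raddfB /= p_Tk dTC -raddfB; congr dT.
rewrite exp_neg_ad_lpoly -lpolyC -raddfB /= !leval_lpoly.
by rewrite hornerD hornerN hornerC horner_comp hornerD hornerX hornerC subrK.
Qed.
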